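(* Let $\lambda>0$ and $\varepsilon>0$. Then for all $\mu>0$, $$v^1(\lambda,\mu)\le v^1(\lambda+\varepsilon,\mu),$$ where $v^1(\lambda,\mu)$ denotes the speed of the one-dimensional variable speed biased random walk with parameters $\lambda,\mu$ on dynamical conductances on $\mathbb{Z}$.
   Context: Fix $\kappa>0$ and a probability measure $q$ on $[0,\kappa]$ with $q\neq\delta_0$. Dynamical conductances $(\omega_t)_{t\ge 0}$ on $\mathbb{Z}$ with refresh rate $\mu>0$: the values $\omega_0(\{x,x+1\})$, $x\in\mathbb{Z}$, are i.i.d. with law $q$, and each edge, independently of the others, resamples its conductance from $q$ (independently of everything else) at the points of a Poisson process of rate $\mu$. One-dimensional variable speed biased random walk (VBRW) with parameters $\lambda>0$, $\mu>0$: $X_0=0$ and, given the environment, when at $x$ at time $t$ the walker jumps to $x+1$ at rate $\omega_t(\{x,x+1\})e^{\lambda}$ and to $x-1$ at rate $\omega_t(\{x-1,x\})e^{-\lambda}$. $\mathbb{P}$ is the joint (annealed) law. The speed is $v^1(\lambda,\mu)=\lim_{t\to\infty}X_t/t$, which exists $\mathbb{P}$-a.s. and is a deterministic constant. *)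

(* Defs.v *)
From HB Require Import structures.
From mathcomp Require Import all_boot all_order all_algebra.
From mathcomp Require Import all_classical all_reals all_analysis.

Set Implicit Arguments.
Unset Strict Implicit.
Unset Printing Implicit Defensive.

Import Order.TTheory GRing.Theory Num.Theory.
Import numFieldNormedType.Exports.

Local Open Scope classical_set_scope.
Local Open Scope ring_scope.

Definition has_law (d : measure_display) (T : measurableType d) (R : realType)
    (P : probability T R) (X : {RV P >-> R}) (nu : set R -> \bar R) : Prop :=
  forall A : set R, measurable A -> distribution P X A = nu A.

Definition mutually_independent (d : measure_display) (T : measurableType d)
    (R : realType) (P : probability T R) (I : choiceType)
    (X : I -> {RV P >-> R}) : Prop :=
  forall (s : seq I) (B : I -> set R), uniq s -> (forall i, measurable (B i)) ->
    P (\bigcap_(i in [set` s]) (X i @^-1` B i)) =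
    (\prod_(i <- s) P (X i @^-1` B i))%E.

(* The edge {x, x+1} of the integer line is encoded by its left endpoint x. *)
Section DynamicalConductances.
Variable R : realType.

(* n-th point of a point process on ]0, +oo[ with interarrival times tau;
   point 0 is the time origin, not a refresh. *)
Definition arrival (tau : nat -> R) (n : nat) : R := \sum_(i < n) tau i.

(* Number of points in ]0, t]; for i.i.d. exponential tau there is almost surely
   exactly one such n for every t >= 0, and the default 0 is then never used. *)
Definition refresh_count (tau : nat -> R) (t : R) : nat :=
  xget 0%N [set n | arrival tau n <= t < arrival tau n.+1].

(* eta x 0 is the initial conductance of the edge x and eta x n the value drawn
   at its n-th refresh. *)
Definition conductance (eta tau : int -> nat -> R) (x : int) (t : R) : R :=
  eta x (refresh_count (tau x) t).

End DynamicalConductances.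

Section Walk.
Variable R : realType.
(* Quenched environment: omega x t is the conductance of {x, x+1} at time t. *)
Variables (omega : int -> R -> R) (lambda : R).

(* Directions: true is a jump from x to x + 1, false a jump from x to x - 1. *)
Definition jump_rate (right : bool) (x : int) (t : R) : R :=
  if right then omega x t * expR lambda else omega (x - 1) t * expR (- lambda).

(* A clock of time-dependent rate r, started at time s, rings when the rate
   accumulated since s reaches the level e; for e exponential of parameter 1 the
   probability of not ringing before t is exp (- \int_s^t r). A clock that never
   rings has ringing time +oo, the infimum of the empty set. *)
Definition ring_time (r : R -> R) (s e : R) : \bar R :=
  ereal_inf [set t%:E | t in
    [set t : R | s <= t /\
      (e%:E <= \int[lebesgue_measure]_(u in `[s, t]) (r u)%:E)%E]].

(* From x at time s, the two clocks attached to the jumps out of x compete. *)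
Definition next_jump (s : R) (x : int) (e : bool -> R) : \bar R * int :=
  let right_time := ring_time (jump_rate true x) s (e true) in
  let left_time := ring_time (jump_rate false x) s (e false) in
  if (right_time < left_time)%E then (right_time, x + 1)
  else (left_time, x - 1).

(* Time of the n-th jump and position just after it; both clocks are renewed
   after each jump, clk b n being the levels used for jump n.+1. Once a jump
   time is infinite no further jump occurs. *)
Fixpoint jump_chain (clk : bool -> nat -> R) (n : nat) : \bar R * int :=
  match n with
  | 0%N => (0%E, 0)
  | m.+1 => let: (s, x) := jump_chain clk m in
      match s with
      | s'%:E => next_jump s' x (fun b => clk b m)
      | _ => (s, x)
      end
  end.

Definition walk (clk : bool -> nat -> R) (t : R) : int :=
  (jump_chain clk
     (xget 0%N [set n | ((jump_chain clk n).1 <= t%:E)%E /\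
                        (t%:E < (jump_chain clk n.+1).1)%E])).2.

End Walk.

Definition noise_index : choiceType :=
  (int * nat + int * nat + bool * nat)%type.

Definition noise_family (A : Type) (eta tau : int -> nat -> A)
    (clk : bool -> nat -> A) (i : noise_index) : A :=
  match i with
  | inl (inl (x, n)) => eta x n
  | inl (inr (x, n)) => tau x n
  | inr (b, n) => clk b n
  end.

Record driving_noise (d : measure_display) (T : measurableType d)
    (R : realType) (P : probability T R) (q : set R -> \bar R) (mu : R)
    (eta tau : int -> nat -> {RV P >-> R})
    (clk : bool -> nat -> {RV P >-> R}) : Prop := DrivingNoise {
  conductance_law : forall x n, has_law (eta x n) q;
  refresh_gap_law : forall x n, has_law (tau x n) (exponential_prob mu);
  clock_law : forall b n, has_law (clk b n) (exponential_prob 1);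
  noise_independent : mutually_independent (noise_family eta tau clk) }.

Definition vbrw (R : realType) (T : Type) (lambda : R)
    (eta tau : int -> nat -> T -> R) (clk : bool -> nat -> T -> R)
    (t : R) (w : T) : int :=
  walk (conductance (fun x n => eta x n w) (fun x n => tau x n w)) lambda
       (fun b n => clk b n w) t.

(* v is the almost sure limit of X_t / t. The law of the walk is determined by
   q, lambda and mu, so the choice of the realization is immaterial. *)
Definition is_speed (R : realType) (q : set R -> \bar R) (lambda mu v : R)
    : Prop :=
  exists (d : measure_display) (T : measurableType d) (P : probability T R)
    (eta tau : int -> nat -> {RV P >-> R}) (clk : bool -> nat -> {RV P >-> R}),
    driving_noise q mu eta tau clk /\
    {ae P, forall w : T,
      (vbrw lambda eta tau clk t w)%:~R / t @[t --> +oo] --> v}.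

(* Main.v *)
Require Import Defs.
From HB Require Import structures.
From mathcomp Require Import all_boot all_order all_algebra.
From mathcomp Require Import all_classical all_reals all_analysis.
From mathcomp Require Import measurable_realfun ring lra zify.

(* Stochastic monotonicity for a fixed environment omega. Let S_n and X_n be the
   jump times and positions. Conditionally on everything but one clock of level
   e, the time-integral of the corresponding jump rate while the walk waits is
   min(e, rho), where rho is the hazard available to that clock before the
   competing clock or the horizon stops it, and the jump occurs iff e <= rho (up
   to e = rho). As E min(e, rho) = P(e <= rho) for e exponential, jump
   probabilities are integrals of jump rates against the occupation probabilities.
   This gives non-explosion, and counting the crossings of the edge {y - 1, y}
   shows that f(y, t) = P(X_t >= y) solves
     f(y, t) = 1_{y <= 0} + \int_0^t omega(y - 1, u)
       (e^lambda (f(y - 1, u) - f(y, u)) - e^-lambda (f(y, u) - f(y + 1, u))) du.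
   Since f is nonincreasing in y, increasing lambda increases the right-hand side,
   and a maximum principle for this infinite linear system shows that f increases
   with lambda. Integrating over the environment, P(X_t >= y) is nondecreasing in
   lambda for all t and y, which orders the almost sure limits of X_t / t. *)

Set Implicit Arguments.
Unset Strict Implicit.
Unset Printing Implicit Defensive.

Import Order.TTheory GRing.Theory Num.Theory.
Import numFieldNormedType.Exports.

Local Open Scope classical_set_scope.
Local Open Scope ring_scope.

(** * Laws of independent families *)

(** [is_speed] lets each speed choose its own probability space, so the two walks cannot be compared
    path by path; only laws can be transported, by the equality of the laws of the driving noises. A
    common noise would give no evident order either: levels are indexed by the number of jumps
    already made, so once the two paths differ, the same level may serve different sites and times.
    Hence the comparison goes through the one-time marginals of the walk.

    No Markov property is set up. Resampling one coordinate of the noise replaces conditioning, and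
    the identity for a single clock, summed over the jump numbers, yields the forward equation.

    The conductances are only bounded and measurable in time. The equation therefore stays in
    integral form, with Lipschitz solutions, and an infimum over the infinitely many sites need not
    be attained. So the maximum principle does not argue at a minimal point: it improves a uniform
    lower bound of the difference of the tails, starting from -1, which is free because tails lie in
    [0, 1]. *)

Section Cylinders.
Variables (R : realType) (I : choiceType).

Definition cylinder (s : seq I) (B : I -> set R) : set (I -> R) :=
  [set k | forall i, i \in s -> B i (k i)].

Definition cylinders : set (set (I -> R)) :=
  [set C | exists s B, (forall i, measurable (B i)) /\ C = cylinder s B].

Local Notation noise_space := (g_sigma_algebraType cylinders).

Lemma cylinders_setI : setI_closed cylinders.
Proof.
move=> _ _ [s [B [mB ->]]] [s' [B' [mB' ->]]].
exists (s ++ s'), (fun i => (if i \in s then B i else setT) `&`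
  (if i \in s' then B' i else setT)); split.
  by move=> i; apply: measurableI; case: ifP.
apply/seteqP; split=> k /=.
  move=> [ks ks'] i _; split; case: ifPn => // si; [exact: ks|exact: ks'].
move=> ks; split=> i si; have := ks i; rewrite mem_cat si ?orbT => /(_ isT)[].
  by [].
by [].
Qed.

Lemma measurable_coord (i : I) :
  measurable_fun [set: noise_space] (fun k : noise_space => k i : R).
Proof.
move=> _ B mB; rewrite setTI; apply: sub_sigma_algebra.
exists [:: i], (fun=> B); split=> //.
by apply/seteqP; split=> k /= Bk; [move=> j /[!inE] /eqP ->|apply: Bk; rewrite inE].
Qed.

Lemma measurable_fun_noise d (T : measurableType d) (f : T -> noise_space) :
  (forall i, measurable_fun [set: T] (fun w => f w i)) ->
  measurable_fun [set: T] f.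
Proof.
move=> mf; apply: (measurability (cylinders : set (set noise_space))) => //.
move=> _ [_ [s [B [mB ->]]] <-]; rewrite setTI.
rewrite (_ : _ @^-1` _ = \big[setI/setT]_(i <- s) ((fun w => f w i) @^-1` B i)).
  by apply: bigsetI_measurable => i _; rewrite -[X in measurable X]setTI; exact: mf.
rewrite -bigcap_seq; apply/seteqP; split=> w /=.
  by move=> fw i /= si; exact: fw.
by move=> fw i si; exact: fw.
Qed.

End Cylinders.

Notation noise_space R I := (g_sigma_algebraType (@cylinders R I)).

(** Independence for bare functions instead of bundled random variables, so that it applies to the
    mixed family on [T * T] and to the clipped levels. *)
Definition independent_family d (T : measurableType d) (R : realType)
    (P : probability T R) (I : choiceType) (X : I -> T -> R) :=
  forall (s : seq I) (B : I -> set R), uniq s -> (forall i, measurable (B i)) ->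
    P (\bigcap_(i in [set` s]) (X i @^-1` B i)) =
    (\prod_(i <- s) P (X i @^-1` B i))%E.

Section Law.
Variables (R : realType) (I : choiceType).
Variables (d d' : measure_display) (T : measurableType d) (T' : measurableType d').
Variables (P : probability T R) (P' : probability T' R).
Variables (X : I -> T -> R) (X' : I -> T' -> R).
Hypotheses (mX : forall i, measurable_fun setT (X i))
  (mX' : forall i, measurable_fun setT (X' i)).
Hypotheses (iX : independent_family P X) (iX' : independent_family P' X').
Hypothesis XX' : forall i B, measurable B -> P (X i @^-1` B) = P' (X' i @^-1` B).

(** Cylinders form a generating pi-system, and on a cylinder both image laws are products of
    marginals, which agree by [XX']. *)
Lemma integral_noise_law (F : noise_space R I -> \bar R) :
  measurable_fun setT F -> (forall k, 0 <= F k)%E ->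
  (\int[P]_w F (fun i => X i w) = \int[P']_w F (fun i => X' i w))%E.
Proof.
move=> mF F0.
pose f (w : T) : noise_space R I := fun i => X i w.
pose f' (w : T') : noise_space R I := fun i => X' i w.
have mf : measurable_fun setT f by exact: measurable_fun_noise.
have mf' : measurable_fun setT f' by exact: measurable_fun_noise.
pose X0 : {mfun T >-> noise_space R I} :=
  HB.pack f (isMeasurableFun.Build _ _ _ _ _ mf).
pose X0' : {mfun T' >-> noise_space R I} :=
  HB.pack f' (isMeasurableFun.Build _ _ _ _ _ mf').
rewrite -(@ge0_integral_distribution _ _ _ _ _ P X0 F)//.
rewrite -(@ge0_integral_distribution _ _ _ _ _ P' X0' F)//.
apply: eq_measure_integral => A mA _.
apply: (@measure_unique _ R (noise_space R I) (@cylinders R I) (fun=> setT)) => //.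
- exact: cylinders_setI.
- by move=> _; exists [::], (fun=> setT); split=> //; apply/seteqP; split.
- by rewrite bigcup_const//; exists 0%N.
- move=> _ [s [B [mB ->]]].
  (* A cylinder may list an index twice, whereas independence speaks of duplicate-free lists. *)
  have cE (U : Type) (Y : I -> U -> R) : (fun w i => Y i w) @^-1` cylinder s B =
      \bigcap_(i in [set` undup s]) (Y i @^-1` B i).
    apply/seteqP; split=> w /= h i /=.
      by rewrite mem_undup; exact: h.
    by move=> si; apply: h; rewrite /= mem_undup.
  transitivity (P (f @^-1` cylinder s B)) => //.
  transitivity (P' (f' @^-1` cylinder s B)) => //.
  rewrite /f /f' !cE iX ?undup_uniq// iX' ?undup_uniq//.
  by apply: eq_bigr => i _; exact: XX'.
- by move=> _; rewrite /= /distribution /pushforward preimage_setT probability_setT ltry.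
Qed.

End Law.

Section Split.
Variables (R : realType) (I : choiceType).
Variables (d : measure_display) (T : measurableType d) (P : probability T R).
Variables (X : I -> T -> R).
Hypotheses (mX : forall i, measurable_fun setT (X i)) (iX : independent_family P X).
Variable D : pred I.

Let Y i (w : T * T) := if D i then X i w.1 else X i w.2.

Let mY i : measurable_fun setT (Y i).
Proof.
rewrite /Y; case: (D i).
  exact: (measurableT_comp (mX i) measurable_fst).
exact: (measurableT_comp (mX i) measurable_snd).
Qed.

Let preimY i B : Y i @^-1` B =
  if D i then (X i @^-1` B) `*` setT else setT `*` (X i @^-1` B).
Proof.
by rewrite /Y; case: (D i); apply/seteqP; split=> -[w1 w2] //= [].
Qed.

Let mXB i B : measurable B -> measurable (X i @^-1` B).
Proof. by move=> mB; rewrite -[X in measurable X]setTI; exact: mX. Qed.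

Let lawY i B : measurable B -> P (X i @^-1` B) = (P \x P)%E (Y i @^-1` B).
Proof.
move=> mB; rewrite preimY; case: (D i).
  by rewrite product_measure1E//= ?probability_setT ?mule1//; exact: mXB.
by rewrite product_measure1E//= ?probability_setT ?mul1e//; exact: mXB.
Qed.

Let indepY : independent_family (P \x P)%E Y.
Proof.
move=> s B us mB.
pose A D' := \bigcap_(i in [set` [seq i <- s | D' i]]) (X i @^-1` B i).
have mA D' : measurable (A D').
  by rewrite /A bigcap_seq; apply: bigsetI_measurable => i _; exact: mXB.
rewrite (_ : \bigcap_(i in _) _ = A D `*` A (predC D)).
  rewrite [LHS]product_measure1E//= iX ?filter_uniq// iX ?filter_uniq//.
  rewrite !big_filter [RHS](bigID D)/=; congr (_ * _)%E; apply: eq_bigr => i Di;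
  by rewrite -lawY.
apply/seteqP; split=> -[w1 w2] /=.
  move=> h; split=> i /=; rewrite mem_filter => /andP[Di si];
  by have := h i si; rewrite /Y/=; move: Di => /=; case: (D i).
move=> [h1 h2] i /= si; rewrite /Y/=; case: ifPn => Di.
  by apply: h1; rewrite /= mem_filter Di.
by apply: h2; rewrite /= mem_filter /= Di.
Qed.

(** Substitute for conditioning on the coordinates in [D]: taking the others from an independent
    copy does not change the law of the family, and the inner integral then acts as a conditional
    expectation. It serves twice, with [D] everything but one clock level and with [D] the
    environment. *)
Lemma integral_noise_split (F : noise_space R I -> \bar R) :
  measurable_fun setT F -> (forall k, 0 <= F k)%E ->
  (\int[P]_w F (fun i => X i w) =
   \int[P]_w1 \int[P]_w2 F (fun i => if D i then X i w1 else X i w2))%E.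
Proof.
move=> mF F0.
rewrite (integral_noise_law mX mY iX indepY lawY mF F0).
rewrite (fubini_tonelli1 (fun w => F (fun i => Y i w)))//.
have mf : measurable_fun setT (fun w => (fun i => Y i w) : noise_space R I).
  exact: measurable_fun_noise.
exact: (measurableT_comp mF mf).
Qed.

End Split.

(** * Ringing times *)

Section Hazard.
Variables (R : realType) (r : R -> R) (C : R).
Hypotheses (mr : measurable_fun setT r) (C0 : 0 < C).
Hypothesis rC : forall u, 0 <= r u <= C.

Definition hazard (r : R -> R) (s t : R) : R :=
  \int[lebesgue_measure]_(u in `[s, t]) r u.

Lemma integrable_rate (s t : R) (b b' : bool) :
  lebesgue_measure.-integrable [set` Interval (BSide b s) (BSide b' t)] (EFin \o r).
Proof.
apply: measurable_bounded_integrable => //.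
- by rewrite /= lebesgue_measure_itv/=; case: ifP; rewrite ltry.
- exact: measurable_funTS.
- exists C; split; first exact: num_real.
  move=> x Cx u _ /=; have /andP[r0 rc] := rC u.
  by rewrite ger0_norm//; apply: le_trans rc (ltW Cx).
Qed.

Lemma hazardE s t : (\int[lebesgue_measure]_(u in `[s, t]) (r u)%:E)%E = (hazard r s t)%:E.
Proof.
rewrite /hazard /Rintegral fineK//; apply: integrable_fin_num => //.
exact: integrable_rate.
Qed.

Lemma hazard_ge0 s t : 0 <= hazard r s t.
Proof. by apply: Rintegral_ge0 => u _; case/andP: (rC u). Qed.

Lemma hazard_le s t : s <= t -> hazard r s t <= C * (t - s).
Proof.
move=> st; rewrite -lee_fin -hazardE.
apply: (@le_trans _ _ (\int[lebesgue_measure]_(u in `[s, t]) C%:E)%E).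
  apply: ge0_le_integral => //.
  - by move=> u _; rewrite lee_fin; case/andP: (rC u).
  - by apply/measurable_EFinP; exact: measurable_funTS.
  - by move=> u _; rewrite lee_fin; case/andP: (rC u).
rewrite integral_cst//= lebesgue_measure_itv/= lte_fin; case: ltP => [_|_].
  by rewrite -EFinB -EFinM.
by rewrite mule0 lee_fin mulr_ge0 ?subr_ge0// ltW.
Qed.

Lemma hazard_split s u t : s <= u -> u <= t ->
  hazard r s t = hazard r s u + hazard r u t.
Proof.
move=> su ut; rewrite /hazard -[X in _ + X]Rintegral_itv_obnd_cbnd; last first.
  exact: integrable_rate.
rewrite -(@Rintegral_itvB _ _ (BLeft s) (BRight t) u)//.
- by rewrite addrC subrK.
- exact: integrable_rate.
Qed.

Lemma hazardxx s : hazard r s s = 0.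
Proof.
by apply/eqP; rewrite eq_le hazard_ge0 (le_trans (hazard_le _))// subrr mulr0.
Qed.

Lemma hazard_mono s u t : s <= u -> u <= t -> hazard r s u <= hazard r s t.
Proof. by move=> su ut; rewrite (hazard_split su ut) lerDl hazard_ge0. Qed.

Lemma le_ring_time s e : (s%:E <= ring_time r s e)%E.
Proof. by apply: le_ereal_inf_tmp => _ [t [st _] <-]; rewrite lee_fin. Qed.

(** The infimum is attained: as the rate is at most [C], a level above [hazard r s t] is not reached
    before some definite time after [t]. *)
Lemma ring_time_le s e t : s <= t -> (ring_time r s e <= t%:E)%E = (e <= hazard r s t).
Proof.
move=> st; apply/idP/idP; last first.
  by move=> eH; apply: ereal_inf_lbound; exists t => //; split=> //; rewrite hazardE lee_fin.
apply: contraTT; rewrite -!ltNge => He.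
(* The least time in which a rate bounded by [C] can accumulate the missing hazard. *)
pose d := (e - hazard r s t) / C.
have d0 : 0 < d by rewrite divr_gt0// subr_gt0.
apply: (@lt_le_trans _ _ (t + d)%:E); first by rewrite lte_fin ltrDl.
apply: le_ereal_inf_tmp => _ [t' [st' +] <-]; rewrite hazardE !lee_fin => eH'.
have tt' : t <= t'.
  rewrite leNgt; apply/negP => /ltW t't.
  have := hazard_mono st' t't; rewrite leNgt => /negP; apply.
  exact: lt_le_trans He eH'.
rewrite -lerBrDl /d ler_pdivrMr// mulrC.
apply: le_trans (hazard_le tt'); rewrite lerBlDl -hazard_split//.
Qed.

Lemma ring_time_lt s e t : 0 <= e -> e < hazard r s t -> s <= t ->
  (ring_time r s e < t%:E)%E.
Proof.
move=> e0 eH; rewrite le_eqVlt => /predU1P[st|st].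
  by move: eH; rewrite st hazardxx ltNge e0.
(* Going back from [t] by [d] loses at most [C * d <= hazard r s t - e] and does not pass [s]. *)
pose d := Num.min ((hazard r s t - e) / C) (t - s).
have d0 : 0 < d by rewrite lt_min divr_gt0 ?subr_gt0.
have sd : s <= t - d by rewrite lerBrDr -lerBrDl ge_min lexx orbT.
have dt : t - d <= t by rewrite gerBl ltW.
apply: (@le_lt_trans _ _ (t - d)%:E); last by rewrite lte_fin gtrBl.
rewrite ring_time_le//; have := hazard_le dt.
have -> : t - (t - d) = d by ring.
move=> Hd.
have /(le_trans Hd) : C * d <= hazard r s t - e.
  by rewrite mulrC -ler_pdivlMr// ge_min lexx.
by rewrite (hazard_split sd dt); lra.
Qed.

Lemma hazard_ring_time s e t : 0 <= e -> s <= t -> ring_time r s e = t%:E ->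
  hazard r s t = e.
Proof.
move=> e0 st rt; apply/eqP; rewrite eq_le -ring_time_le// rt lexx andbT leNgt.
by apply/negP => /ring_time_lt-/(_ e0 st); rewrite rt ltxx.
Qed.

(** The hazard is continuous, so when the clock rings it equals [e] without overshoot; if [z] comes
    first, it has not yet reached [e]. *)
Lemma hazard_stopped s e z y : 0 <= e -> s <= z -> (y%:E = mine (ring_time r s e) z%:E)%E ->
  hazard r s y = Num.min e (hazard r s z).
Proof.
move=> e0 sz; have [rz|zr] := leP (ring_time r s e) z%:E.
  move=> yE; rewrite min_l -?ring_time_le//; apply: hazard_ring_time => //.
  by have := le_ring_time s e; rewrite -yE.
by case=> ->; rewrite min_r// leNgt; apply/negP => /ltW; rewrite -ring_time_le// leNgt zr.
Qed.

End Hazard.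

(** * Measurability of the walk *)

Section MeasurableGlue.
Context d d' (W : measurableType d) (U : measurableType d').

(** Stated through the fibres, so that [K] needs no sigma-algebra. *)
Definition measurable_discrete (K : countType) (X : W -> K) :=
  forall x, measurable_fun setT (fun w => X w == x).

Lemma measurable_preimage (f : W -> U) (A : set U) :
  measurable_fun setT f -> measurable A -> measurable (f @^-1` A).
Proof. by move=> mf mA; rewrite -[X in measurable X]setTI; exact: mf. Qed.

Lemma measurable_setb (f : W -> bool) :
  measurable_fun setT f -> measurable [set w | f w].
Proof.
by move=> mf; rewrite -[X in measurable X]setTI; apply: (mf _ [set true]).
Qed.

Lemma measurable_glue (K : countType) (X : W -> K) (f : K -> W -> U) :
  measurable_discrete X -> (forall x, measurable_fun setT (f x)) ->
  measurable_fun setT (fun w => f (X w) w).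
Proof.
move=> mX mf _ A mA; rewrite setTI.
rewrite (_ : _ @^-1` _ = \bigcup_x ([set w | X w == x] `&` f x @^-1` A)).
  apply: countable_bigcupT_measurable => [|x]; first exact: countableP.
  apply: measurableI.
    by have := mX x measurableT [set true]; rewrite setTI; exact.
  exact: measurable_preimage.
apply/seteqP; split=> w /=; first by move=> Aw; exists (X w) => //; split=> /=.
by move=> [x _ [/eqP <-]].
Qed.

End MeasurableGlue.

Section MeasurableRing.
Variables (R : realType) (d : measure_display) (W : measurableType d).

(** By [ring_time_le] the infimum over uncountably many times exceeds [t] unless [s <= t] and an
    integral over time reaches [e]; that integral is measurable in [w] by Fubini-Tonelli. *)
Lemma measurable_ring_time (r : W -> R -> R) (C : R) (s e : W -> R) :
  measurable_fun setT (fun p : W * R => r p.1 p.2) ->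
  0 < C -> (forall w u, 0 <= r w u <= C) ->
  measurable_fun setT s -> measurable_fun setT e ->
  measurable_fun setT (fun w => ring_time (r w) (s w) (e w)).
Proof.
move=> mr C0 rC ms me.
have mrw w : measurable_fun setT (r w) by exact: (measurable_fun_pair2 w mr).
apply: (measurability (@ErealGenOInfty.G R)).
  exact: ErealGenOInfty.measurableE.
move=> _ [_ [t ->] <-]; rewrite setTI.
rewrite (_ : _ @^-1` _ =
    ~` [set w | (s w <= t) && ((e w)%:E <= (\int[lebesgue_measure]_u
      (if s w <= u <= t then r w u else 0)%:E))%E]); last first.
  have sE w : s w <= t -> (\int[lebesgue_measure]_u
      (if s w <= u <= t then r w u else 0)%:E)%E = (hazard (r w) (s w) t)%:E.
    move=> st; rewrite -(hazardE (mrw w) (rC w)) [RHS]integral_mkcond.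
    apply: eq_integral => u _; rewrite patchE mem_setE in_itv/=.
    by case: ifP.
  apply/seteqP; split=> w /=; rewrite in_itv/= andbT.
    move=> tr /andP[st]; rewrite sE// lee_fin.
    by rewrite -(ring_time_le (mrw w) C0 (rC w))// leNgt tr.
  move=> /negP; rewrite negb_and => /orP[st|].
    rewrite -ltNge in st.
    by apply: lt_le_trans (le_ring_time _ _ _); rewrite lte_fin.
  case: (leP (s w) t) => st.
    by rewrite sE// -ltNge lte_fin ltNge -(ring_time_le (mrw w) C0 (rC w))// -ltNge.
  by move=> _; apply: lt_le_trans (le_ring_time _ _ _); rewrite lte_fin.
apply/measurableC/measurable_setb/measurable_and.
  exact: measurable_fun_ler.
apply: measurable_fun_lee; first exact/measurable_EFinP.
apply: (@measurable_fun_fubini_tonelli_F _ _ _ _ _ lebesgue_measure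
  (fun p : W * R => (if s p.1 <= p.2 <= t then r p.1 p.2 else 0)%:E)).
  apply/measurable_EFinP; apply: measurable_fun_ifT => //.
  apply: measurable_and; apply: measurable_fun_ler => //.
  exact: measurableT_comp.
by move=> p; rewrite lee_fin; case: ifP => // _; case/andP: (rC p.1 p.2).
Qed.

End MeasurableRing.

(** Only successors are covered: 0 is also the default of [xget], so the value 0 does not imply
    [P 0]. *)
Lemma xget_eqS (P : set nat) n : (forall m m', P m -> P m' -> m = m') ->
  (xget 0%N P == n.+1) = `[< P n.+1 >].
Proof.
move=> P1; apply/eqP/asboolP => [|Pn].
  by case: (xgetP 0%N P) => // m _ Pm <-.
by apply: xget_unique => // m Pm; exact: P1 Pm Pn.
Qed.

Lemma nondecreasing_window (d : Order.disp_t) (T : orderType d) (a : nat -> T) (t : T) :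
  (forall n, (a n <= a n.+1)%O) ->
  forall m m', (a m <= t < a m.+1)%O -> (a m' <= t < a m'.+1)%O -> m = m'.
Proof.
move=> /(homo_leq (@le_refl _ T) (@le_trans _ T)) a_mono.
have W m m' : (a m <= t < a m.+1)%O -> (a m' <= t < a m'.+1)%O -> (m <= m')%N.
  move=> /andP[am _] /andP[_ am']; rewrite leqNgt; apply/negP => mm'.
  by have := lt_le_trans am' (le_trans (a_mono _ _ mm') am); rewrite ltxx.
by move=> m m' hm hm'; apply/eqP; rewrite eqn_leq !W.
Qed.

(** The fibre over 0, where the default may hide, is the complement of the others. *)
Lemma measurable_discreteS d (W : measurableType d) (N : W -> nat) :
  (forall n, measurable_fun setT (fun w => N w == n.+1)) -> measurable_discrete N.
Proof.
move=> mN [|n]; last exact: mN.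
apply: (measurable_fun_bool true); rewrite setTI.
rewrite (_ : _ @^-1` _ = ~` (\bigcup_n [set w | N w == n.+1])).
  apply/measurableC/bigcupT_measurable => n; exact: measurable_setb.
apply/seteqP; split=> w /=; first by move=> N0 [n _ /=]; rewrite (eqP N0).
by case E : (N w) => [//|n] []; exists n => //=; rewrite E.
Qed.

(** Adaptedness: the first [n] jumps do not look at the levels numbered [n] or more, so resampling
    such a level leaves the past unchanged. *)
Lemma jump_chain_ext (R : realType) (omega : int -> R -> R) (lambda : R)
    (clk clk' : bool -> nat -> R) n :
  (forall b m, (m < n)%N -> clk b m = clk' b m) ->
  jump_chain omega lambda clk n = jump_chain omega lambda clk' n.
Proof.
elim: n => // n IH h /=; rewrite IH => [|b m mn]; last by rewrite h// ltnS ltnW.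
case: (jump_chain _ _ _ n) => -[s| |] x //.
by rewrite /next_jump !h.
Qed.

Section JumpChainPath.
Variables (R : realType) (omega : int -> R -> R) (lambda : R).
Variable clk : bool -> nat -> R.

Definition jump_time n : \bar R := (jump_chain omega lambda clk n).1.
Definition jump_pos n : int := (jump_chain omega lambda clk n).2.

(** The value of [fine] at an infinite [jump_time n] is harmless, since the chain is then frozen.
    The site [x] is a separate argument so that [measurable_glue] can vary it. *)
Definition ring_at n b x : \bar R :=
  ring_time (jump_rate omega lambda b x) (fine (jump_time n)) (clk b n).

Definition goes_right n : bool :=
  (ring_at n true (jump_pos n) < ring_at n false (jump_pos n))%E.

Lemma goes_rightE n : goes_right n =
  (ring_at n true (jump_pos n) < ring_at n false (jump_pos n))%E.
Proof. by []. Qed.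

Lemma jump_timeS n : jump_time n.+1 =
  if jump_time n \is a fin_num
  then mine (ring_at n true (jump_pos n)) (ring_at n false (jump_pos n))
  else jump_time n.
Proof.
rewrite /ring_at /jump_time /jump_pos /=.
case: (jump_chain _ _ _ n) => -[s| |] x //=.
by rewrite /next_jump /mine; case: ifP.
Qed.

Lemma jump_posS n : jump_pos n.+1 =
  if jump_time n \is a fin_num
  then (if goes_right n then jump_pos n + 1 else jump_pos n - 1)
  else jump_pos n.
Proof.
rewrite /goes_right /ring_at /jump_time /jump_pos /=.
case: (jump_chain _ _ _ n) => -[s| |] x //=.
by rewrite /next_jump; case: ifP.
Qed.

Lemma jump_time_ge0 n : (0 <= jump_time n)%E.
Proof.
elim: n => // n IH; rewrite jump_timeS; case: ifPn => // fS.
have T0 b : (0 <= ring_at n b (jump_pos n))%E.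
  by apply: le_trans (le_ring_time _ _ _); rewrite lee_fin fine_ge0.
rewrite le_min; apply/andP; split; exact: T0.
Qed.

Lemma jump_time_mono n : (jump_time n <= jump_time n.+1)%E.
Proof.
rewrite jump_timeS; case: ifPn => // fS.
have T0 b : (jump_time n <= ring_at n b (jump_pos n))%E.
  by rewrite -{1}(fineK fS); exact: le_ring_time.
rewrite le_min; apply/andP; split; exact: T0.
Qed.

Lemma jump_time_window (t : R) m m' :
  (jump_time m <= t%:E < jump_time m.+1)%E ->
  (jump_time m' <= t%:E < jump_time m'.+1)%E -> m = m'.
Proof. exact: (nondecreasing_window jump_time_mono). Qed.

End JumpChainPath.

Section JumpChain.
Variables (R : realType) (d : measure_display) (W : measurableType d).
Variables (omega : W -> int -> R -> R) (kappa lambda : R).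
Hypothesis kappa0 : 0 < kappa.
Hypothesis omega_bnd : forall w x u, 0 <= omega w x u <= kappa.
Hypothesis momega : forall x, measurable_fun setT (fun p : W * R => omega p.1 x p.2).
Variable clk : W -> bool -> nat -> R.
Hypothesis mclk : forall b n, measurable_fun setT (fun w => clk w b n).

(** One bound for both directions; the sum of the two exponentials is also the constant of the
    maximum principle. *)
Definition rate_bound := kappa * (expR lambda + expR (- lambda)).

Lemma rate_bound_gt0 : 0 < rate_bound.
Proof. by rewrite mulr_gt0// addr_gt0// expR_gt0. Qed.

Lemma jump_rate_bnd w b x u :
  0 <= jump_rate (omega w) lambda b x u <= rate_bound.
Proof.
rewrite /jump_rate /rate_bound mulrDr; case: b.
  have /andP[w0 wk] := omega_bnd w x u; rewrite mulr_ge0 ?expR_ge0//=.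
  by rewrite -[leLHS]addr0 lerD ?mulr_ge0 ?expR_ge0 ?ler_wpM2r ?expR_ge0// ltW.
have /andP[w0 wk] := omega_bnd w (x - 1) u; rewrite mulr_ge0 ?expR_ge0//=.
by rewrite -[leLHS]add0r lerD ?mulr_ge0 ?expR_ge0 ?ler_wpM2r ?expR_ge0// ltW.
Qed.

Lemma measurable_jump_rate b x :
  measurable_fun setT (fun p : W * R => jump_rate (omega p.1) lambda b x p.2).
Proof. by case: b; apply: measurable_funM. Qed.

Local Notation S n w := (jump_time (omega w) lambda (clk w) n).
Local Notation X n w := (jump_pos (omega w) lambda (clk w) n).

Lemma measurable_ring_at n b : measurable_fun setT (fun w => S n w) ->
  measurable_discrete (fun w => X n w) ->
  measurable_fun setT (fun w => ring_at (omega w) lambda (clk w) n b (X n w)).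
Proof.
move=> mS mX.
apply: (measurable_glue mX (f := fun x w => ring_at (omega w) lambda (clk w) n b x)) => x.
  apply: (@measurable_ring_time _ _ _ _ rate_bound) => //.
  - exact: measurable_jump_rate.
  - exact: rate_bound_gt0.
  - by move=> w u; exact: jump_rate_bnd.
  - exact: (measurableT_comp (fine_measurable measurableT)).
Qed.

Lemma measurable_jump_chain n :
  measurable_fun setT (fun w => S n w) /\ measurable_discrete (fun w => X n w).
Proof.
elim: n => [|n [mS mX]]; first by split=> //= x; exact: measurable_cst.
have mT b : measurable_fun setT (fun w => ring_at (omega w) lambda (clk w) n b (X n w)).
  exact: measurable_ring_at.
have mfin : measurable_fun setT (fun w => S n w \is a fin_num).
  apply: (measurable_fun_bool true).
  exact: emeasurable_fin_num.
have mlt : measurable_fun setT (fun w => goes_right (omega w) lambda (clk w) n).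
  exact: measurable_fun_lte.
split.
  under eq_fun do rewrite jump_timeS.
  by do 2 apply: measurable_fun_ifT => //.
move=> x; under eq_fun do rewrite jump_posS.
rewrite (_ : (fun w => _) = (fun w => if S n w \is a fin_num then
   (if goes_right (omega w) lambda (clk w) n then X n w == x - 1 else X n w == x + 1)
    else X n w == x)).
  by do 2 apply: measurable_fun_ifT => //.
apply/funext => w; case: ifP => // _; case: ifP => // _.
  by rewrite [in RHS]eq_sym subr_eq eq_sym.
by rewrite subr_eq.
Qed.

Lemma measurable_goes_right n :
  measurable_fun setT (fun w => goes_right (omega w) lambda (clk w) n).
Proof.
have [mS mX] := measurable_jump_chain n.
have mT b : measurable_fun setT (fun w => ring_at (omega w) lambda (clk w) n b (X n w)).
  exact: measurable_ring_at.
exact: measurable_fun_lte.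
Qed.

Lemma measurable_walk (t : R) :
  measurable_discrete (fun w => walk (omega w) lambda (clk w) t).
Proof.
move=> y; rewrite /walk.
pose N w := xget 0%N [set n | (S n w <= t%:E)%E /\ (t%:E < S n.+1 w)%E].
apply: (measurable_glue (X := N) (f := fun n w => X n w == y)) => [|n]; last first.
  exact: (measurable_jump_chain n).2.
apply: measurable_discreteS => n.
rewrite (_ : (fun w => _) = (fun w => (S n.+1 w <= t%:E)%E && (t%:E < S n.+2 w)%E)).
  apply: measurable_and; [apply: measurable_fun_lee|apply: measurable_fun_lte] => //;
  exact: (measurable_jump_chain _).1.
apply/funext => w; rewrite xget_eqS; first by apply/asboolP/andP.
move=> m m' /andP Pm /andP Pm'.
exact: jump_time_window Pm Pm'.
Qed.

End JumpChain.

Section Conductance.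
Variables (R : realType) (d : measure_display) (W : measurableType d).
Variables (eta tau : W -> int -> nat -> R).
Hypothesis meta : forall x n, measurable_fun setT (fun w => eta w x n).
Hypothesis mtau : forall x n, measurable_fun setT (fun w => tau w x n).
Hypothesis tau0 : forall w x n, 0 <= tau w x n.

Lemma measurable_conductance x :
  measurable_fun setT (fun p : W * R => conductance (eta p.1) (tau p.1) x p.2).
Proof.
have ma n : measurable_fun setT (fun p : W * R => arrival (tau p.1 x) n).
  elim: n => [|n IHn]; rewrite /arrival.
    by under eq_fun do rewrite big_ord0; exact: measurable_cst.
  under eq_fun do rewrite big_ord_recr/=.
  by apply: measurable_funD IHn _; exact: (measurableT_comp (mtau x n)).
apply: (measurable_glue (X := fun p : W * R => refresh_count (tau p.1 x) p.2)
  (f := fun n p => eta p.1 x n)) => [|n]; last first.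
  exact: (measurableT_comp (meta x n)).
apply: measurable_discreteS => n.
rewrite (_ : (fun w => _) = (fun p : W * R => (arrival (tau p.1 x) n.+1 <= p.2) &&
    (p.2 < arrival (tau p.1 x) n.+2))).
  by apply: measurable_and; [apply: measurable_fun_ler|apply: measurable_fun_ltr].
apply/funext => p; rewrite xget_eqS; first exact: asboolb.
apply: nondecreasing_window => m.
by rewrite /arrival big_ord_recr/= lerDl.
Qed.

End Conductance.

Section Extensionality.
Variables (R : realType) (omega : int -> R -> R) (lambda : R).
Variables (clk clk' : bool -> nat -> R) (n : nat).
Hypothesis clkE : forall b m, (m < n)%N -> clk b m = clk' b m.

Lemma jump_time_ext : jump_time omega lambda clk n = jump_time omega lambda clk' n.
Proof. by rewrite /jump_time (jump_chain_ext _ _ clkE). Qed.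

Lemma jump_pos_ext : jump_pos omega lambda clk n = jump_pos omega lambda clk' n.
Proof. by rewrite /jump_pos (jump_chain_ext _ _ clkE). Qed.

Lemma ring_at_ext b x : clk b n = clk' b n ->
  ring_at omega lambda clk n b x = ring_at omega lambda clk' n b x.
Proof. by rewrite /ring_at jump_time_ext => ->. Qed.

End Extensionality.

#[global] Opaque jump_time jump_pos ring_at goes_right.

(** * Jump intensities *)

Section Exponential.
Variables (R : realType) (d : measure_display) (T : measurableType d).
Variables (P : probability T R) (e : T -> R).
Hypothesis me : measurable_fun setT e.
Hypothesis e0 : forall w, 0 <= e w.
Hypothesis law_e : forall A, measurable A -> P (e @^-1` A) = exponential_prob 1 A.

Lemma exponential_prob_ler (x : R) : 0 <= x ->
  P [set w | e w <= x] = exponential_prob 1 `[0, x].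
Proof.
move=> x0; rewrite -law_e//; congr (P _); apply/seteqP; split=> w /=.
  by rewrite in_itv/= e0.
by rewrite in_itv/= => /andP[].
Qed.

(** Absence of atoms, which later makes the undecided case e = rho negligible. *)
Lemma exponential_prob_ltr (x : R) : 0 <= x ->
  P [set w | e w < x] = P [set w | e w <= x].
Proof.
move=> x0; rewrite exponential_prob_ler// /exponential_prob.
rewrite -integral_itv_bndo_bndc; last first.
  by apply/measurable_EFinP/measurable_funTS; exact: measurable_exponential_pdf.
rewrite -/(exponential_prob 1 _) -law_e//; congr (P _); apply/seteqP; split=> w /=.
  by rewrite in_itv/= e0.
by rewrite in_itv/= => /andP[].
Qed.

(** At parameter 1 the density is its own survival function; [exponential_min] rests on this
    coincidence. *)
Lemma exponential_prob_gtr (x : R) : 0 <= x ->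
  P [set w | x < e w] = (exponential_pdf 1 x)%:E.
Proof.
move=> x0; rewrite (_ : [set w | x < e w] = ~` [set w | e w <= x]); last first.
  by apply/seteqP; split=> w /=; rewrite ltNge => /negP.
rewrite probability_setC; last by apply: measurable_setb; exact: measurable_fun_ler.
rewrite exponential_prob_ler// exponential_pdfE// mul1r.
move: x0; rewrite le_eqVlt => /predU1P[<-|x0].
  by rewrite set_itv1 /exponential_prob integral_set1 sube0 mulN1r oppr0 expR0.
rewrite exponential_prob_itv0c//. congr (_%:E); ring.
Qed.

(** The expectation is the integral of the survival function over [0, x], that is, of the density,
    that is, the probability of [0, x]. *)
Lemma exponential_min (x : R) : 0 <= x ->
  (\int[P]_w (Num.min (e w) x)%:E)%E = P [set w | e w <= x].
Proof.
move=> x0; pose m w := Num.min (e w) x.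
have mm : measurable_fun setT m by exact: measurable_minr.
pose X : {RV P >-> R} := HB.pack m (isMeasurableFun.Build _ _ _ _ _ mm).
have := @ge0_expectation_ccdf _ _ _ P X; rewrite expectation_def => ->; last first.
  by move=> w; rewrite /X/= /m le_min e0.
rewrite exponential_prob_ler// /exponential_prob -integral_itv_bndo_bndc; last first.
  by apply/measurable_EFinP/measurable_funTS; exact: measurable_exponential_pdf.
rewrite integral_mkcond [RHS]integral_mkcond; apply: eq_integral => u _.
rewrite !patchE !mem_setE !in_itv/= andbT; case: (leP 0 u) => //= u0.
rewrite /ccdf /distribution /pushforward; case: ifPn => ux.
  rewrite -exponential_prob_gtr//; congr (P _); apply/seteqP; split=> w /=;
  by rewrite in_itv/= andbT /m lt_min ux andbT.
rewrite [X in P X](_ : _ = set0) ?measure0//; apply/seteqP; split=> w //=.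
by rewrite in_itv/= andbT /m lt_min (negbTE ux) andbF.
Qed.

End Exponential.

Lemma occupation_hazard (R : realType) (r : R -> R) (C s t : R) (z : \bar R) :
  measurable_fun setT r -> 0 < C -> (forall u, 0 <= r u <= C) -> s <= t -> (s%:E <= z)%E ->
  (\int[lebesgue_measure]_u
     (if [&& s <= u, ((u : R)%:E < z)%E & u <= t] then r u else 0)%:E)%E =
  (hazard r s (fine (mine z t%:E)))%:E.
Proof.
move=> mr C0 rC st sz; have [zt|tz] := leP z t%:E.
  have zfin : z \is a fin_num.
    by rewrite fin_numE; apply/andP; split; apply/eqP => zE; move: sz zt; rewrite zE.
  rewrite -(hazardE mr rC) -integral_itv_bndo_bndc; last first.
    by apply/measurable_EFinP; exact: measurable_funTS.
  rewrite [RHS]integral_mkcond; apply: eq_integral => u _.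
  rewrite patchE mem_setE in_itv/=.
  rewrite -(fineK zfin) !lte_fin in sz zt *; case: (leP s u) => //= su.
  by case: ltP => //= uz; rewrite (le_trans (ltW uz)).
rewrite -(hazardE mr rC) [RHS]integral_mkcond; apply: eq_integral => u _.
rewrite patchE mem_setE in_itv/=; case: (leP s u) => //= su.
case: (leP u t) => ut; last by rewrite andbF.
by rewrite andbT (le_lt_trans _ tz).
Qed.

Lemma fin_num_between (R : realDomainType) (x : \bar R) (a b : R) :
  (a%:E <= x)%E -> (x <= b%:E)%E -> x \is a fin_num.
Proof. by case: x. Qed.

Section Pathwise.
Variables (R : realType) (omega : int -> R -> R) (kappa lambda : R).
Hypothesis kappa0 : 0 < kappa.
Hypothesis omega_bnd : forall x u, 0 <= omega x u <= kappa.
Hypothesis momega : forall x, measurable_fun setT (omega x).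

Local Notation C := (rate_bound kappa lambda).
Local Notation rate := (jump_rate omega lambda).

Lemma quenched_rate_bnd b x u : 0 <= rate b x u <= C.
Proof. exact: (@jump_rate_bnd _ _ (measurableTypeR R) (fun=> omega)). Qed.

Lemma measurable_quenched_rate b x : measurable_fun setT (rate b x).
Proof. by case: b; apply: measurable_funM. Qed.

Let C0 : 0 < C. Proof. exact: rate_bound_gt0. Qed.
Let mr := measurable_quenched_rate.
Let rC := quenched_rate_bnd.

(** The intensity of [jump_event] below: its integral over time is the compensator of that event. *)
Definition active_rate b n (D : pred int) (tau : R) (clk : bool -> nat -> R) (u : R) : R :=
  if [&& D (jump_pos omega lambda clk n), (jump_time omega lambda clk n <= u%:E)%E,
         (u%:E < jump_time omega lambda clk n.+1)%E & u <= tau]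
  then rate b (jump_pos omega lambda clk n) u else 0.

Definition jump_event b n (D : pred int) (tau : R) (clk : bool -> nat -> R) : bool :=
  [&& D (jump_pos omega lambda clk n), (jump_time omega lambda clk n.+1 <= tau%:E)%E
    & goes_right omega lambda clk n == b].

Section OneJump.
Variables (b : bool) (n : nat) (D : pred int) (tau : R) (clk : bool -> nat -> R).
Local Notation S := (jump_time omega lambda clk n).
Local Notation X := (jump_pos omega lambda clk n).
Local Notation ring c := (ring_at omega lambda clk n c X).

(** The rho of the overview. It reads the earlier levels and the competing one, but not [clk b n],
    so resampling [clk b n] leaves it fixed. *)
Definition level_reached : R :=
  hazard (rate b X) (fine S) (fine (mine (ring (~~ b)) tau%:E)).

Hypotheses (DX : D X) (Stau : (S <= tau%:E)%E) (e0 : 0 <= clk b n).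

Let Sfin : S \is a fin_num.
Proof.
exact: (fin_num_between (jump_time_ge0 _ _ _ _) Stau).
Qed.

Let S_ring c : (S <= ring c)%E.
Proof. by rewrite -{1}(fineK Sfin); exact: le_ring_time. Qed.

Let SE : S = (fine S)%:E. Proof. by rewrite fineK. Qed.

Let minfin (t : \bar R) : (S <= t)%E -> (fine (mine t tau%:E))%:E = mine t tau%:E.
Proof.
move=> St; rewrite fineK//.
apply: (@fin_num_between _ _ 0 tau); last by rewrite ge_min lexx orbT.
rewrite le_min; apply/andP; split.
  exact: le_trans (jump_time_ge0 _ _ _ _) St.
exact: le_trans (jump_time_ge0 _ _ _ _) Stau.
Qed.

Let z := fine (mine (ring (~~ b)) tau%:E).
Let zE : z%:E = mine (ring (~~ b)) tau%:E. Proof. exact: minfin. Qed.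

Let sz : fine S <= z.
Proof. by rewrite -lee_fin zE -SE le_min S_ring Stau. Qed.

Let nextE : jump_time omega lambda clk n.+1 = mine (ring b) (ring (~~ b)).
Proof.
rewrite jump_timeS Sfin; case: b; first by [].
by rewrite [RHS]minC.
Qed.

Lemma level_reached_ge0 : 0 <= level_reached.
Proof. exact: (hazard_ge0 (rC b X)). Qed.

Lemma integral_active_rate :
  (\int[lebesgue_measure]_u (active_rate b n D tau clk u)%:E)%E =
  (Num.min (clk b n) level_reached)%:E.
Proof.
transitivity (\int[lebesgue_measure]_u
   (if [&& fine S <= u, ((u : R)%:E < jump_time omega lambda clk n.+1)%E & u <= tau]
    then rate b X u else 0)%:E)%E.
  apply: eq_integral => u _; rewrite /active_rate DX/=.
  by rewrite [in LHS]SE lee_fin.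
rewrite (occupation_hazard (mr b X) C0 (rC b X)); last 2 first.
  by rewrite -lee_fin -SE.
  by rewrite -SE; exact: jump_time_mono.
(* The next jump stopped at [tau] is the ring of clock [b] stopped at [z], the competing ring cut at
   [tau]. *)
congr (_%:E); apply: (hazard_stopped (mr b X) C0 (rC b X)) => //.
by rewrite minfin ?jump_time_mono// -/z zE nextE minA.
Qed.

(** With [le_jump_event] this leaves only [clk b n = level_reached] open. There the outcome depends
    on [b], since simultaneous rings are resolved to the left. *)
Lemma jump_event_lt : clk b n < level_reached -> jump_event b n D tau clk.
Proof.
move=> /(ring_time_lt (mr b X) C0 (rC b X) e0)/(_ sz); rewrite -/(ring_at _ _ _ _ _ _) zE.
rewrite lt_min => /andP[r1 r2]; rewrite /jump_event DX nextE/=; apply/andP; split.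
  by rewrite ge_min (ltW r2).
rewrite goes_rightE; case: b r1 => /= r1; first by rewrite r1.
by rewrite ltNge (ltW r1).
Qed.

Lemma le_jump_event : jump_event b n D tau clk -> clk b n <= level_reached.
Proof.
rewrite /jump_event DX nextE/= => /andP[r1 dirb].
rewrite /level_reached -(ring_time_le (mr b X) C0 (rC b X) _ sz).
rewrite -/(ring_at _ _ _ _ _ _) -/z zE le_min.
suff rb : (ring b <= ring (~~ b))%E by rewrite rb; move: r1; rewrite min_l.
move: dirb; rewrite goes_rightE; case: b => /= /eqP; first by move=> /ltW.
by move=> /negbT; rewrite -leNgt.
Qed.

End OneJump.

Lemma active_rate_eq0 b n (D : pred int) (tau : R) (clk : bool -> nat -> R) u :
  ~~ (D (jump_pos omega lambda clk n) && (jump_time omega lambda clk n <= tau%:E)%E) ->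
  active_rate b n D tau clk u = 0.
Proof.
rewrite /active_rate; case: ifP => // /and4P[-> Su _ ut] /=.
by rewrite (le_trans Su).
Qed.

Lemma jump_event_eq0 b n (D : pred int) (tau : R) (clk : bool -> nat -> R) :
  ~~ (D (jump_pos omega lambda clk n) && (jump_time omega lambda clk n <= tau%:E)%E) ->
  jump_event b n D tau clk = false.
Proof.
apply: contraNF => /and3P[-> St _] /=.
exact: le_trans (jump_time_mono _ _ _ _) St.
Qed.

Lemma active_rate_ge0 b n D tau clk u : 0 <= active_rate b n D tau clk u.
Proof.
rewrite /active_rate; case: ifP => // _.
by case/andP: (rC b (jump_pos omega lambda clk n) u).
Qed.

End Pathwise.

Lemma integral_ifb (R : realType) d (T : measurableType d) (P : probability T R)
    (f : T -> bool) : measurable_fun setT f ->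
  (\int[P]_w (if f w then 1 else 0)%:E)%E = P [set w | f w].
Proof.
move=> mf; rewrite -[X in P X]setIT -integral_indic//; last exact: measurable_setb.
apply: eq_integral => w _; rewrite indicE; case: ifPn => h; first by rewrite mem_set.
by rewrite memNset//; exact/negP.
Qed.

Section Quenched.
Variables (R : realType) (omega : int -> R -> R) (kappa lambda : R).
Hypothesis kappa0 : 0 < kappa.
Hypothesis omega_bnd : forall x u, 0 <= omega x u <= kappa.
Hypothesis momega : forall x, measurable_fun setT (omega x).

Local Notation C := (rate_bound kappa lambda).
Local Notation rate := (jump_rate omega lambda).

Section Measurability.
Context d (W : measurableType d).
Variables (clk : W -> bool -> nat -> R) (u : W -> R).
Hypothesis mclk : forall b n, measurable_fun setT (fun w => clk w b n).
Hypothesis mu : measurable_fun setT u.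

Lemma measurable_quenched_chain n :
  measurable_fun setT (fun w => jump_time omega lambda (clk w) n) /\
  measurable_discrete (fun w => jump_pos omega lambda (clk w) n).
Proof.
apply: (@measurable_jump_chain _ _ W (fun=> omega) kappa) => // x.
exact: (measurableT_comp (momega x)).
Qed.

Lemma measurable_pos_pred n (D : pred int) :
  measurable_fun setT (fun w => D (jump_pos omega lambda (clk w) n)).
Proof.
exact: (measurable_glue (measurable_quenched_chain n).2 (f := fun x _ => D x)).
Qed.

Lemma measurable_active_rate b n D tau :
  measurable_fun setT (fun w => active_rate omega lambda b n D tau (clk w) (u w)).
Proof.
apply: measurable_fun_ifT => //.
- apply: measurable_and; first exact: measurable_pos_pred.
  apply: measurable_and.
    apply: measurable_fun_lee; first exact: (measurable_quenched_chain _).1.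
    exact/measurable_EFinP.
  apply: measurable_and; last exact: measurable_fun_ler.
  apply: measurable_fun_lte; last exact: (measurable_quenched_chain _).1.
  exact/measurable_EFinP.
- apply: (measurable_glue (measurable_quenched_chain n).2
    (f := fun x w => rate b x (u w))) => x.
  exact: (measurableT_comp (measurable_quenched_rate _ momega b x)).
Qed.

Lemma measurable_jump_event b n D tau :
  measurable_fun setT (fun w => jump_event omega lambda b n D tau (clk w)).
Proof.
apply: measurable_and; first exact: measurable_pos_pred.
apply: measurable_and.
  by apply: measurable_fun_lee => //; exact: (measurable_quenched_chain _).1.
have mg : measurable_fun setT (fun w => goes_right omega lambda (clk w) n).
  apply: (@measurable_goes_right _ _ W (fun=> omega) kappa) => // x.
  exact: (measurableT_comp (momega x)).
case: b; first by under eq_fun do rewrite eqb_id.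
by under eq_fun do rewrite eqbF_neg; exact: measurable_neg.
Qed.

End Measurability.

Section Intensity.
Variables (d : measure_display) (T : measurableType d) (P : probability T R).
Variable e : bool * nat -> T -> R.
Hypothesis me : forall i, measurable_fun setT (e i).
Hypothesis e0 : forall i w, 0 <= e i w.
Hypothesis law_e : forall i A, measurable A -> P (e i @^-1` A) = exponential_prob 1 A.
Hypothesis indep_e : independent_family P e.

Local Notation K := (noise_space R (bool * nat)%type).
Definition clocks (k : bool * nat -> R) (b : bool) (n : nat) : R := k (b, n).
Local Notation clkT w := (clocks (fun i => e i w)).

Let mclkK b n : measurable_fun setT (fun k : K => clocks k b n).
Proof. exact: measurable_coord. Qed.

Let mclkT b n : measurable_fun setT (fun w => clkT w b n).
Proof. exact: me. Qed.

(** With all coordinates frozen except the level [(b, n)], the time integral is min(e, rho) with rho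
    constant, and both sides become P(e <= rho). If the chain is not in [D] or has passed [tau] at
    its [n]-th jump, both vanish. *)
Lemma jump_intensity b n D tau :
  P [set w | jump_event omega lambda b n D tau (clkT w)] =
  (\int[lebesgue_measure]_u \int[P]_w
     (active_rate omega lambda b n D tau (clkT w) u)%:E)%E.
Proof.
pose F1 (k : K) := (\int[lebesgue_measure]_u
  (active_rate omega lambda b n D tau (clocks k) u)%:E)%E.
pose F2 (k : K) : \bar R :=
  (if jump_event omega lambda b n D tau (clocks k) then 1 else 0)%:E.
have ge0r clk u := active_rate_ge0 lambda kappa0 omega_bnd b n D tau clk u.
transitivity (\int[P]_w F1 (fun i => e i w))%E; last first.
  apply: (@fubini_tonelli _ _ _ _ _ P lebesgue_measure (fun p : T * _ =>
    (active_rate omega lambda b n D tau (clkT p.1) p.2)%:E)).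
    apply/measurable_EFinP; apply: measurable_active_rate => // b' n'.
    exact: (measurableT_comp (me (b', n'))).
  by move=> p; rewrite lee_fin.
transitivity (\int[P]_w F2 (fun i => e i w))%E.
  by rewrite /F2 integral_ifb//; exact: measurable_jump_event.
rewrite (integral_noise_split me indep_e (predC1 (b, n))); last 2 first.
- apply/measurable_EFinP; apply: measurable_fun_ifT => //.
  exact: measurable_jump_event.
- by move=> k; rewrite /F2 lee_fin; case: ifP.
rewrite [RHS](integral_noise_split me indep_e (predC1 (b, n))); last 2 first.
- apply: (@measurable_fun_fubini_tonelli_F _ _ _ _ _ lebesgue_measure (fun p : K * _ =>
    (active_rate omega lambda b n D tau (clocks p.1) p.2)%:E)).
    apply/measurable_EFinP; apply: measurable_active_rate => // b' n'.
    exact: (measurableT_comp (measurable_coord (b', n'))).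
  by move=> p; rewrite lee_fin.
- by move=> k; apply: integral_ge0 => u _; rewrite lee_fin.
apply: eq_integral => w1 _.
pose mix w2 i := if predC1 (b, n) i then e i w1 else e i w2.
have mixE w2 b' m : (m < n)%N -> clocks (mix w2) b' m = clkT w1 b' m.
  by move=> mn; rewrite /clocks /mix/= xpair_eqE (ltn_eqF mn) andbF.
have mixb w2 : clocks (mix w2) b n = e (b, n) w2 by rewrite /clocks /mix/= eqxx.
have mixNb w2 : clocks (mix w2) (~~ b) n = clkT w1 (~~ b) n.
  by rewrite /clocks /mix/= xpair_eqE eqxx andbT; case: (b).
have tE w2 := jump_time_ext omega lambda (mixE w2).
have xE w2 := jump_pos_ext omega lambda (mixE w2).
have [/andP[DX Stau]|inactive] :=
    boolP (D (jump_pos omega lambda (clkT w1) n) &&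
           (jump_time omega lambda (clkT w1) n <= tau%:E)%E); last first.
  transitivity (\int[P]_w2 (0 : \bar R))%E.
    by apply: eq_integral => w2 _; rewrite /F2 jump_event_eq0// xE tE.
  apply: eq_integral => w2 _; rewrite /F1 integral0_eq// => u _.
  by rewrite active_rate_eq0// xE tE.
pose rho := level_reached omega lambda b n tau (clkT w1).
have rhoE w2 : level_reached omega lambda b n tau (clocks (mix w2)) = rho.
  rewrite /rho /level_reached tE xE.
  by rewrite (ring_at_ext omega lambda (mixE w2) _ (mixNb w2)).
have rho0 : 0 <= rho by exact: (level_reached_ge0 lambda kappa0).
have DXm w2 : D (jump_pos omega lambda (clocks (mix w2)) n) by rewrite xE.
have Sm w2 : (jump_time omega lambda (clocks (mix w2)) n <= tau%:E)%E by rewrite tE.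
have em0 w2 : 0 <= clocks (mix w2) b n by rewrite mixb.
transitivity (P [set w2 | e (b, n) w2 <= rho]); last first.
  rewrite -(exponential_min (me (b, n)) (e0 (b, n)) (law_e (b, n)) rho0).
  apply: eq_integral => w2 _; rewrite /F1 -/(mix w2).
  by rewrite (integral_active_rate kappa0 omega_bnd)// rhoE mixb.
have mEv : measurable_fun setT
    (fun w2 => jump_event omega lambda b n D tau (clocks (mix w2))).
  apply: measurable_jump_event => b' m.
  by rewrite /clocks /mix; case: (predC1 _ _).
transitivity (P [set w2 | jump_event omega lambda b n D tau (clocks (mix w2))]).
  by rewrite -integral_ifb.
(* The event lies between e < rho and e <= rho, which have the same probability. *)
apply/eqP; rewrite eq_le; apply/andP; split.
  apply: le_measure; rewrite ?inE//; [exact: measurable_setb| |].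
    by apply: measurable_setb; exact: measurable_fun_ler.
  move=> w2 /= /(le_jump_event kappa0 omega_bnd momega (DXm w2) (Sm w2)).
  by rewrite rhoE mixb.
rewrite -(exponential_prob_ltr (e0 (b, n)) (law_e (b, n)) rho0).
apply: le_measure; rewrite ?inE//; [|exact: measurable_setb|].
  by apply: measurable_setb; exact: measurable_fun_ltr.
move=> w2 /= h; apply: (jump_event_lt kappa0 omega_bnd momega (DXm w2) (Sm w2) (em0 w2)).
by rewrite rhoE mixb.
Qed.

End Intensity.
End Quenched.

(** * The equation for the tail probabilities *)

(** Exactly [n] jumps have occurred by time [u]. If this fails for every [n] at some [u >= 0], the
    walk has exploded by time [u]. *)
Definition alive (R : realType) (omega : int -> R -> R) (lambda : R) (n : nat) (u : R)
    (clk : bool -> nat -> R) : bool :=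
  (jump_time omega lambda clk n <= u%:E)%E &&
  (u%:E < jump_time omega lambda clk n.+1)%E.

Section Crossing.
Variables (R : realType) (omega : int -> R -> R) (lambda : R).
Variables (clk : bool -> nat -> R) (tau : R).
Hypothesis tau0 : 0 <= tau.
Local Notation S n := (jump_time omega lambda clk n).
Local Notation X n := (jump_pos omega lambda clk n).

Lemma jump_time0 : S 0 = 0%E. Proof. by []. Qed.
Lemma jump_pos0 : X 0 = 0. Proof. by []. Qed.

(** A conservation law: from one jump to the next, the truth of [y <= X] changes only by a right
    jump from [y - 1] or a left jump from [y], unless the walk waits until [tau]. All terms are
    placed so that no subtraction in [nat] occurs. *)
Lemma crossing_step n (y : int) :
  (((S n <= tau%:E)%E && (y <= X n)%R) +
    jump_event omega lambda true n (pred1 (y - 1)%R) tau clk =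
  (alive omega lambda n tau clk && (y <= X n)%R) +
  ((S n.+1 <= tau%:E)%E && (y <= X n.+1)%R) +
  jump_event omega lambda false n (pred1 y) tau clk)%N.
Proof.
rewrite /alive /jump_event.
have SS := jump_time_mono omega lambda clk n.
have [Stau|tauS] := leP (S n) tau%:E; last first.
  have -> : (S n.+1 <= tau%:E)%E = false.
    by apply/negbTE; rewrite -ltNge (lt_le_trans tauS SS).
  by rewrite /= !andbF.
have Sfin := fin_num_between (jump_time_ge0 omega lambda clk n) Stau.
rewrite jump_posS Sfin; case: (leP (S n.+1) tau%:E) => /= _; last first.
  by rewrite !andbF /=; case: (y <= X n).
move: (X n) => x; case: (goes_right omega lambda clk n) => /=; rewrite ?andbF ?andbT /=.
  rewrite -lerBlDr -{1}(subrK 1 y) lezD1.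
  by case: (ltgtP (y - 1) x).
rewrite lerBrDr lezD1.
by case: (ltgtP y x).
Qed.

(** Telescoped [crossing_step]. The middle term on the left, for paths with [m] jumps by time [tau],
    is the one that non-explosion removes in the limit. *)
Lemma crossing_count m (y : int) :
  (\sum_(0 <= n < m) (alive omega lambda n tau clk && (y <= X n)%R) +
  ((S m <= tau%:E)%E && (y <= X m)%R) +
  \sum_(0 <= n < m) jump_event omega lambda false n (pred1 y) tau clk =
  (y <= 0)%R +
  \sum_(0 <= n < m) jump_event omega lambda true n (pred1 (y - 1)%R) tau clk)%N.
Proof.
elim: m => [|m IH].
  by rewrite !big_geq// jump_time0 jump_pos0 lee_fin tau0/=; case: (y <= 0).
have H (A s B c D r a s' l : nat) : (A + s + B = c + D -> s + r = a + s' + l ->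
  A + a + s' + (B + l) = c + (D + r))%N by lia.
by rewrite !big_nat_recr//=; exact: H IH (crossing_step m y).
Qed.

Lemma sum_alive_le1 m : (\sum_(0 <= n < m) alive omega lambda n tau clk <= 1)%N.
Proof.
elim: m => [|m IH]; first by rewrite big_geq.
rewrite big_nat_recr//=; case E: (alive omega lambda m tau clk); last by rewrite addn0.
rewrite big_nat big1// => n /= nm; apply/eqP; rewrite eqb0; apply/negP => nE.
by move: nm; rewrite (jump_time_window nE E) ltnn.
Qed.

Lemma no_alive_time : (forall n, ~~ alive omega lambda n tau clk) ->
  forall m, (S m <= tau%:E)%E.
Proof.
move=> na; elim=> [|m IH]; first by rewrite jump_time0 lee_fin.
by have := na m; rewrite /alive IH/= -leNgt.
Qed.

End Crossing.

Section Occupation.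
Variables (R : realType) (omega : int -> R -> R) (kappa lambda : R).
Hypothesis kappa0 : 0 < kappa.
Hypothesis omega_bnd : forall x u, 0 <= omega x u <= kappa.
Hypothesis momega : forall x, measurable_fun setT (omega x).
Variables (d : measure_display) (T : measurableType d) (P : probability T R).
Variable e : bool * nat -> T -> R.
Hypothesis me : forall i, measurable_fun setT (e i).
Hypothesis e0 : forall i w, 0 <= e i w.
Hypothesis law_e : forall i A, measurable A -> P (e i @^-1` A) = exponential_prob 1 A.
Hypothesis indep_e : independent_family P e.

Local Notation C := (rate_bound kappa lambda).
Local Notation rate := (jump_rate omega lambda).
Local Notation clkT w := (clocks (fun i => e i w)).
Local Notation S n w := (jump_time omega lambda (clkT w) n).
Local Notation X n w := (jump_pos omega lambda (clkT w) n).

Definition visits (D : pred int) (u : R) (n : nat) (w : T) : bool :=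
  alive omega lambda n u (clkT w) && D (X n w).

Let C0 : 0 < C. Proof. exact: rate_bound_gt0. Qed.
Let rC b x u := quenched_rate_bnd lambda kappa0 omega_bnd b x u.

Let mclkT b n : measurable_fun setT (fun w => clkT w b n).
Proof. exact: me. Qed.

Let mS n : measurable_fun setT (fun w => S n w).
Proof. exact: (measurable_quenched_chain lambda kappa0 omega_bnd momega mclkT n).1. Qed.

Lemma measurable_visits2 D n : measurable_fun setT (fun p : T * R => visits D p.2 n p.1).
Proof.
have mclk2 b m : measurable_fun setT (fun p : T * R => clkT p.1 b m).
  exact: (measurableT_comp (mclkT b m)).
have mS2 m := (measurable_quenched_chain lambda kappa0 omega_bnd momega mclk2 m).1.
apply: measurable_and; last exact: (measurable_pos_pred lambda kappa0 omega_bnd momega mclk2).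
by apply: measurable_and; [apply: measurable_fun_lee|apply: measurable_fun_lte] => //;
  exact/measurable_EFinP.
Qed.

Lemma measurable_visits D u n : measurable_fun setT (visits D u n).
Proof. exact: (measurable_fun_pair1 u (measurable_visits2 D n)). Qed.

Lemma alive_ge0 n u clk : alive omega lambda n u clk -> 0 <= u.
Proof.
by move=> /andP[Su _]; rewrite -lee_fin (le_trans _ Su)//; exact: jump_time_ge0.
Qed.

(** The horizon is put into the integrand, so that all time integrals run over the whole line, as in
    [jump_intensity]. *)
Definition window (tau : R) (r : R -> R) (u : R) : R := if 0 <= u <= tau then r u else 0.

Lemma window_ge0 tau b x u : 0 <= window tau (rate b x) u.
Proof. by rewrite /window; case: ifP => // _; case/andP: (rC b x u). Qed.

Lemma measurable_window tau r : measurable_fun setT r -> measurable_fun setT (window tau r).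
Proof.
by move=> mr; apply: measurable_fun_ifT => //; apply: measurable_and; exact: measurable_fun_ler.
Qed.

(** At a prescribed site the quenched rate is deterministic and leaves the expectation. *)
Lemma site_intensity b n x tau :
  P [set w | jump_event omega lambda b n (pred1 x) tau (clkT w)] =
  (\int[lebesgue_measure]_u
    ((window tau (rate b x) u)%:E * P [set w | visits (pred1 x) u n w]))%E.
Proof.
rewrite (jump_intensity lambda kappa0)//; apply: eq_integral => u _.
rewrite -(integral_ifb P (measurable_visits (pred1 x) u n)).
rewrite -ge0_integralZl_EFin//; last 3 first.
- by move=> w _; rewrite lee_fin; case: ifP.
- by apply/measurable_EFinP; apply: measurable_fun_ifT => //; exact: measurable_visits.
- exact: window_ge0.
apply: eq_integral => w _; rewrite -EFinM; congr (_%:E).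
rewrite /active_rate /visits /window.
have al := @alive_ge0 n u (clkT w); rewrite /alive in al *.
rewrite /=; case: (jump_pos omega lambda (clkT w) n =P x) => [->|_] /=; last by rewrite andbF mulr0.
rewrite andbT andbA; move: al.
case: (_ && (u%:E < S n.+1 w)%E) => [/(_ isT) ->|_] /=; last by rewrite mulr0.
by rewrite mulr1.
Qed.

(** The waiting periods are disjoint, so at most one summand is nonzero. *)
Lemma sum_active_rate_le b m tau u (clk : bool -> nat -> R) :
  \sum_(0 <= n < m) active_rate omega lambda b n predT tau clk u <= window tau (fun=> C) u.
Proof.
have aE n : active_rate omega lambda b n predT tau clk u <=
    (alive omega lambda n u clk)%:R * window tau (fun=> C) u.
  rewrite /active_rate /window /=; have al := @alive_ge0 n u clk; rewrite /alive in al *.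
  rewrite andbA; case: ifP => [/andP[a ut]|_].
    by rewrite a (al a) ut mul1r; case/andP: (rC b (jump_pos omega lambda clk n) u).
  by rewrite mulr_ge0//; case: ifP => // _; exact: ltW.
apply: (le_trans (ler_sum _ (fun n _ => aE n))).
rewrite -mulr_suml -natr_sum -[leRHS]mul1r ler_wpM2r//.
  by rewrite /window; case: ifP => // _; exact: ltW.
by rewrite lern1 sum_alive_le1.
Qed.

Lemma integral_window_cst tau c : 0 <= tau ->
  (\int[lebesgue_measure]_u (window tau (fun=> c) u)%:E)%E = (c * tau)%:E.
Proof.
move=> tau0; transitivity (\int[lebesgue_measure]_(u in `[0%R, tau]%classic) c%:E)%E.
  rewrite [RHS]integral_mkcond; apply: eq_integral => u _.
  by rewrite patchE mem_setE in_itv/= /window; case: ifP.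
rewrite integral_cst//= lebesgue_measure_itv/= lte_fin; case: ltP => [_|t0].
  by rewrite sube0 -EFinM.
by rewrite mule0 (le_anti (introT andP (conj t0 tau0))) mulr0.
Qed.

Lemma sum_jump_event_le b m tau : 0 <= tau ->
  (\sum_(0 <= n < m) P [set w | jump_event omega lambda b n predT tau (clkT w)] <= (C * tau)%:E)%E.
Proof.
move=> tau0; under eq_bigr do rewrite (jump_intensity lambda kappa0)//.
have mA n : measurable_fun setT (fun p : T * R =>
    (active_rate omega lambda b n predT tau (clkT p.1) p.2)%:E).
  apply/measurable_EFinP; apply: (measurable_active_rate lambda kappa0 omega_bnd momega) => //.
  by move=> b' n'; exact: (measurableT_comp (mclkT b' n')).
have A0 n clk u : (0 <= (active_rate omega lambda b n predT tau clk u)%:E)%E.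
  by rewrite lee_fin; exact: (active_rate_ge0 lambda kappa0).
rewrite -ge0_integral_sum//; last 2 first.
- move=> n; apply: (@measurable_fun_fubini_tonelli_G _ _ _ _ _ P (fun p : T * R =>
    (active_rate omega lambda b n predT tau (clkT p.1) p.2)%:E)) => //.
- by move=> n u _; apply: integral_ge0.
rewrite -(integral_window_cst C tau0); apply: ge0_le_integral => //.
- by move=> u _; apply: sume_ge0 => n _; exact: integral_ge0.
- apply: emeasurable_sum => n.
  apply: (@measurable_fun_fubini_tonelli_G _ _ _ _ _ P (fun p : T * R =>
    (active_rate omega lambda b n predT tau (clkT p.1) p.2)%:E)) => //.
- by apply/measurable_EFinP; exact: measurable_window.
move=> u _; rewrite -ge0_integral_sum//; last first.
  by move=> n; exact: (measurable_fun_pair1 (u : R) (mA n)).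
apply: (@le_trans _ _ (\int[P]_w (window tau (fun=> C) u)%:E)%E).
  apply: ge0_le_integral => //.
  - by move=> w _; exact: sume_ge0.
  - by apply: emeasurable_sum => n; exact: (measurable_fun_pair1 (u : R) (mA n)).
  - by move=> w _; rewrite sumEFin lee_fin sum_active_rate_le.
by rewrite integral_cst//= probability_setT mule1.
Qed.

(** Markov's inequality for the number of jumps before [tau]: each of the first [m] jumps is at
    least as likely to have occurred as the [m]-th, and each direction contributes at most [C * tau]
    jumps on average. *)
Lemma nonexplosion m tau : 0 <= tau ->
  (P [set w | (S m w <= tau%:E)%E] * m%:R%:E <= (2 * C * tau)%:E)%E.
Proof.
move=> tau0.
have mSt n : measurable [set w | (S n w <= tau%:E)%E].
  by apply: measurable_setb; exact: measurable_fun_lee.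
have mono n : (n < m)%N ->
    (P [set w | (S m w <= tau%:E)%E] <= P [set w | (S n.+1 w <= tau%:E)%E])%E.
  move=> nm; apply: le_measure; rewrite ?inE//.
  move=> w /=; apply: le_trans.
  exact: (homo_leq (@le_refl _ _) (@le_trans _ _) (jump_time_mono omega lambda (clkT w))).
have mje b n : measurable [set w | jump_event omega lambda b n predT tau (clkT w)].
  by apply: measurable_setb; exact: (measurable_jump_event lambda kappa0 omega_bnd momega).
apply: (@le_trans _ _ (\sum_(0 <= n < m) (\sum_(b : bool)
   P [set w | jump_event omega lambda b n predT tau (clkT w)])))%E.
  apply: (@le_trans _ _ (\sum_(0 <= n < m) P [set w | (S m w <= tau%:E)%E])%E).
    by rewrite sumr_const_nat subn0 muleC mule_natl.
  rewrite !big_nat; apply: lee_sum => n /= nm.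
  apply: le_trans (mono n nm) _; rewrite big_bool/=.
  apply: le_trans (measureU2 _ _ _) => //.
  apply: le_measure; rewrite ?inE//; first exact: measurableU.
  move=> w /= Sw; case E: (goes_right omega lambda (clkT w) n);
    by [left; rewrite /jump_event Sw E|right; rewrite /jump_event Sw E].
rewrite exchange_big big_bool/=.
apply: (@le_trans _ _ ((C * tau)%:E + (C * tau)%:E)%E).
  by apply: leeD; exact: sum_jump_event_le.
by rewrite -EFinD lee_fin; lra.
Qed.

(** The law of the position, expressed by the jump number itself rather than by [walk], whose [xget]
    has a default value; [walk_tailE] relates the two. *)
Definition occupation (D : pred int) (u : R) : \bar R :=
  P [set w | exists n, visits D u n w].

Lemma measurable_visited D u : measurable [set w | exists n, visits D u n w].
Proof.
rewrite (_ : [set w | _] = \bigcup_n [set w | visits D u n w]).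
  by apply: bigcupT_measurable => n; apply: measurable_setb; exact: measurable_visits.
by apply/seteqP; split=> w /= [n]; [exists n|move=> _ h; exists n].
Qed.

Lemma occupation_le1 D u : (occupation D u <= 1)%E.
Proof. exact/probability_le1/measurable_visited. Qed.

Lemma occupation_series D u :
  (\sum_(0 <= n <oo) P [set w | visits D u n w] = occupation D u)%E.
Proof.
rewrite -(eq_eseriesl (P := fun i => i \in setT)); last by move=> i; rewrite in_setT.
rewrite -measure_bigcup; last 2 first.
- by move=> n _; apply: measurable_setb; exact: measurable_visits.
- apply/trivIsetP => i j _ _ ij; apply/seteqP; split=> // w [] /= /andP[ai _] /andP[aj _].
  by move: ij; rewrite (jump_time_window ai aj) eqxx.
by congr (P _); apply/seteqP; split=> w /= [n]; [move=> _ h; exists n|exists n].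
Qed.

Lemma measurable_prob_visits D n :
  measurable_fun setT (fun u => P [set w | visits D u n w]).
Proof.
rewrite (_ : (fun _ => _) =
    fun u => (\int[P]_w (if visits D u n w then 1 else 0)%:E)%E); last first.
  by apply/funext => u; rewrite integral_ifb//; exact: measurable_visits.
apply: (@measurable_fun_fubini_tonelli_G _ _ _ _ _ P (fun p : T * R =>
    (if visits D p.2 n p.1 then 1 else 0)%:E)).
  by apply/measurable_EFinP; apply: measurable_fun_ifT => //; exact: measurable_visits2.
by move=> p; rewrite lee_fin; case: ifP.
Qed.

Lemma measurable_occupation D : measurable_fun setT (occupation D).
Proof.
rewrite (_ : occupation D =
    fun u => (\sum_(0 <= n <oo) P [set w | visits D u n w])%E); last first.
  by apply/funext => u; rewrite occupation_series.
apply: (@ge0_emeasurable_sum _ _ _ setT (fun n u => P [set w | visits D u n w]) predT) => // n _.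
exact: measurable_prob_visits.
Qed.

Lemma time_cvg0 (g : nat -> set T) tau : 0 <= tau ->
  (forall m, measurable (g m)) ->
  (forall m, g m `<=` [set w | (S m w <= tau%:E)%E]) -> P (g m) @[m --> \oo] --> 0%E.
Proof.
(* Shifted by one because [harmonic m] is 1 / (m + 1). *)
move=> tau0 mg gS; suff : P (g m.+1) @[m --> \oo] --> 0%E.
  by move=> h; rewrite -(cvg_shiftS (fun m => P (g m)) (nbhs 0%E)).
have sq : \forall m \near \oo,
    (0 <= P (g m.+1) <= (2 * C * tau * harmonic m)%:E)%E.
  apply: nearW => m; rewrite measure_ge0 /harmonic/= EFinM.
  rewrite lee_pdivlMr//.
  apply: le_trans (nonexplosion m.+1 tau0).
  rewrite lee_wpmul2r//; apply: le_measure; rewrite ?inE//.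
  by apply: measurable_setb; exact: measurable_fun_lee.
apply: (squeeze_cvge sq).
- exact: cvg_cst.
- apply: cvg_EFin; first exact: nearW.
  rewrite -(mulr0 (2 * C * tau)); apply: cvgMr; exact: cvg_harmonic.
Qed.

(** Off the event, every jump time is at most [tau], so the constant sequence of its complementary
    probability is dominated by a null sequence. *)
Lemma occupationT tau : 0 <= tau -> occupation predT tau = 1%E.
Proof.
move=> tau0; pose A := [set w | exists n, visits predT tau n w].
have mA : measurable A by exact: measurable_visited.
have : P (~` A) @[m --> \oo] --> 0%E.
  apply: (time_cvg0 tau0) => [m|m w /= nA]; first exact: measurableC.
  apply: (no_alive_time tau0) => n; apply/negP => al; apply: nA; exists n.
  by rewrite /visits al.
move/(cvg_unique _ (cvg_cst _)) => /(_ _)/= A0.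
have := probability_setC P (measurableC mA); rewrite setCK A0//.
by rewrite sube0.
Qed.

Lemma sum_prob (f : nat -> T -> bool) m : (forall n, measurable_fun setT (f n)) ->
  (\sum_(0 <= n < m) P [set w | f n w] =
   \int[P]_w (\sum_(0 <= n < m) f n w)%N%:R%:E)%E.
Proof.
move=> mf; under eq_integral do rewrite natr_sum -sumEFin.
rewrite ge0_integral_sum//.
- apply: eq_bigr => n _; rewrite -integral_ifb//.
  by apply: eq_integral => w _; case: (f n w).
- move=> n; rewrite (_ : (fun w => _) = fun w => (if f n w then 1 else 0)%:E).
    by apply/measurable_EFinP; exact: measurable_fun_ifT.
  by apply/funext => w; case: (f n w).
Qed.

Lemma measurable_sum_bool (f : nat -> T -> bool) m : (forall n, measurable_fun setT (f n)) ->
  measurable_fun setT (fun w => (\sum_(0 <= n < m) f n w)%N%:R%:E : \bar R).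
Proof.
move=> mf; under eq_fun do rewrite natr_sum -sumEFin.
apply: emeasurable_sum => n.
rewrite (_ : (fun w => _) = fun w => (if f n w then 1 else 0)%:E).
  by apply/measurable_EFinP; exact: measurable_fun_ifT.
by apply/funext => w; case: (f n w).
Qed.

Lemma finite_flux m (y : int) tau : 0 <= tau ->
  (\sum_(0 <= n < m) P [set w | visits (fun x => y <= x)%R tau n w] +
   P [set w | (S m w <= tau%:E) && (y <= X m w)%R] +
   \sum_(0 <= n < m) P [set w | jump_event omega lambda false n (pred1 y) tau (clkT w)] =
   ((y <= 0)%R%:R)%:E +
   \sum_(0 <= n < m) P [set w | jump_event omega lambda true n (pred1 (y - 1)%R) tau (clkT w)])%E.
Proof.
move=> tau0.
have mje b D n := measurable_jump_event lambda kappa0 omega_bnd momega mclkT b n D tau.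
have mv n : measurable_fun setT (visits (fun x => y <= x) tau n) by exact: measurable_visits.
have mSX : measurable_fun setT (fun w => (S m w <= tau%:E)%E && (y <= X m w)).
  apply: measurable_and; first exact: measurable_fun_lee.
  exact: (measurable_pos_pred lambda kappa0 omega_bnd momega mclkT m (fun x => y <= x)).
have := sum_prob 1 (fun=> mSX); rewrite big_nat1 => ->.
rewrite !sum_prob//.
have msum f k := @measurable_sum_bool f k.
have s0 (k : nat) : (0 <= (k%:R : R)%:E)%E by rewrite lee_fin.
rewrite -ge0_integralD//; [|by apply: msum|by apply: msum].
rewrite -ge0_integralD//;
  [|by move=> w _; rewrite adde_ge0| |by apply: msum => n; exact: mje]; last first.
  by apply: emeasurable_funD; apply: msum.
have cE : (\int[P]_w ((y <= 0)%R%:R : R)%:E)%E = ((y <= 0)%R%:R)%:E.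
  by rewrite integral_cst//= probability_setT mule1.
rewrite -cE.
rewrite -ge0_integralD//; last by apply: msum => n; exact: mje.
apply: eq_integral => w _; rewrite -!EFinD -!natrD; congr (_%:R%:E).
by rewrite big_nat1; exact: crossing_count.
Qed.

Lemma site_flux b x tau :
  (\sum_(0 <= n < m) P [set w | jump_event omega lambda b n (pred1 x) tau (clkT w)])%E
    @[m --> \oo] -->
  (\int[lebesgue_measure]_u ((window tau (rate b x) u)%:E * occupation (pred1 x) u))%E.
Proof.
rewrite [V in _ --> V](_ : _ = (\sum_(0 <= n <oo)
    P [set w | jump_event omega lambda b n (pred1 x) tau (clkT w)])%E).
  exact: is_cvg_nneseries.
under eq_eseriesr do rewrite site_intensity.
rewrite -integral_nneseries//; last 2 first.
- move=> n; apply: emeasurable_funM.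
    apply/measurable_EFinP; apply: measurable_window.
    exact: (measurable_quenched_rate lambda momega).
  exact: measurable_prob_visits.
- by move=> n u _; rewrite mule_ge0// lee_fin window_ge0.
by apply: eq_integral => u _; rewrite nneseriesZl// occupation_series.
Qed.

Lemma flux_equation (y : int) tau : 0 <= tau ->
  (occupation (fun x => y <= x)%R tau +
     \int[lebesgue_measure]_u
       ((window tau (rate false y) u)%:E * occupation (pred1 y) u) =
   ((y <= 0)%R%:R)%:E + \int[lebesgue_measure]_u
       ((window tau (rate true (y - 1)%R) u)%:E * occupation (pred1 (y - 1)%R) u))%E.
Proof.
move=> tau0.
have fin b x : (\int[lebesgue_measure]_u
    ((window tau (rate b x) u)%:E * occupation (pred1 x) u))%E \is a fin_num.
  apply: (@fin_num_between _ _ 0 (C * tau)).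
    by apply: integral_ge0 => u _; rewrite mule_ge0 ?lee_fin ?window_ge0// measure_ge0.
  rewrite -(integral_window_cst C tau0); apply: ge0_le_integral => //.
  - by move=> u _; rewrite mule_ge0 ?lee_fin ?window_ge0// measure_ge0.
  - apply: emeasurable_funM; last exact: measurable_occupation.
    apply/measurable_EFinP; apply: measurable_window.
    exact: (measurable_quenched_rate lambda momega).
  - by apply/measurable_EFinP; exact: measurable_window.
  - move=> u _; apply: (@le_trans _ _ ((window tau (rate b x) u)%:E * 1)%E).
      apply: lee_wpmul2l; [by rewrite lee_fin window_ge0|exact: occupation_le1].
    rewrite mule1 lee_fin /window; case: ifP => // _.
    by case/andP: (rC b x u).
have cA : (\sum_(0 <= n < m) P [set w | visits (fun x => y <= x)%R tau n w])%E
    @[m --> \oo] --> occupation (fun x => y <= x)%R tau.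
  by rewrite -occupation_series; exact: is_cvg_nneseries.
(* Non-explosion enters here: no mass is lost after infinitely many jumps. *)
have cS : P [set w | (S m w <= tau%:E)%E && (y <= X m w)%R] @[m --> \oo] --> 0%E.
  apply: (time_cvg0 tau0) => [m|m w /= /andP[]//].
  apply: measurable_setb; apply: measurable_and; first exact: measurable_fun_lee.
  exact: (measurable_pos_pred lambda kappa0 omega_bnd momega mclkT m (fun x => y <= x)).
have cB := @site_flux false y tau.
have cD := @site_flux true (y - 1) tau.
have ofin D u : occupation D u \is a fin_num.
  by rewrite fin_num_measure//; exact: measurable_visited.
have cL := cvgeD (fin_num_adde_defl _ (fin false y))
  (cvgeD (fin_num_adde_defr _ (ofin _ _)) cA cS) cB.
have cR := cvgeD (fin_num_adde_defl _ (fin true (y - 1)))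
  (cvg_cst (((y <= 0)%R%:R)%:E : \bar R)) cD.
rewrite -[occupation _ tau]adde0.
rewrite -[LHS](cvg_lim (@ereal_hausdorff R) (cL _ _)) -[RHS](cvg_lim (@ereal_hausdorff R) (cR _ _)).
by congr (lim (_ @ \oo)); apply/funext => m; exact: finite_flux.
Qed.

Definition tail_prob (y : int) (u : R) : R := fine (occupation (fun x => y <= x) u).

Lemma occupation_fin D u : occupation D u \is a fin_num.
Proof. by rewrite fin_num_measure//; exact: measurable_visited. Qed.

Lemma tail_prob_bnd y u : 0 <= tail_prob y u <= 1.
Proof.
by rewrite /tail_prob -!lee_fin fineK ?occupation_fin// measure_ge0 occupation_le1.
Qed.

Lemma occupation1E y u : occupation (pred1 y) u = (tail_prob y u - tail_prob (y + 1) u)%:E.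
Proof.
rewrite EFinB /tail_prob !fineK ?occupation_fin//.
apply/esym/eqP; rewrite sube_eq ?occupation_fin//; last first.
  by rewrite fin_num_adde_defl// occupation_fin.
rewrite /occupation -measureU; last 3 first.
- exact: measurable_visited.
- exact: measurable_visited.
- apply/seteqP; split=> // w [] /= [n /andP[an /eqP xn]] [m /andP[am]].
  by rewrite (jump_time_window am an) xn gerDl.
apply/eqP; congr (P _); apply/seteqP; split=> w /=.
  move=> [n /andP[an yX]]; have [xy|] := eqVneq (X n w) y; last first.
    move=> /negbTE yX'; right; exists n; rewrite /visits an/= lezD1.
    by rewrite lt_def yX' yX.
  by left; exists n; rewrite /visits an/= xy.
case=> -[n /andP[an yX]]; exists n; rewrite /visits an/=.
  by rewrite (eqP yX).
by apply: le_trans yX; rewrite lerDl.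
Qed.

Lemma tail_prob_nincr y u : tail_prob (y + 1) u <= tail_prob y u.
Proof. by rewrite -subr_ge0 -lee_fin -occupation1E measure_ge0. Qed.

Lemma measurable_tail_prob y : measurable_fun setT (tail_prob y).
Proof. exact: (measurableT_comp (fine_measurable measurableT) (measurable_occupation _)). Qed.

Definition drift (lambda : R) (omega : int -> R -> R) (f : int -> R -> R) (y : int) (u : R) : R :=
  omega (y - 1) u * (expR lambda * (f (y - 1) u - f y u) -
                     expR (- lambda) * (f y u - f (y + 1) u)).

Let flow b x u : R := rate b x u * (tail_prob x u - tail_prob (x + 1) u).

Let mflow b x : measurable_fun setT (flow b x).
Proof.
apply: measurable_funM; first exact: (measurable_quenched_rate lambda momega).
by apply: measurable_funB; exact: measurable_tail_prob.
Qed.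

Let flow_bnd b x u : 0 <= flow b x u <= C.
Proof.
rewrite /flow; have /andP[r0 r1] := rC b x u; have /andP[a0 a1] := tail_prob_bnd x u.
have /andP[b0 b1] := tail_prob_bnd (x + 1) u.
have ab := tail_prob_nincr x u.
rewrite mulr_ge0 ?subr_ge0//= -[leRHS]mulr1 ler_pM ?subr_ge0//.
by rewrite lerBlDr (le_trans a1)// lerDl.
Qed.

Let flowE b x tau : (\int[lebesgue_measure]_u
    ((window tau (rate b x) u)%:E * occupation (pred1 x) u))%E =
  (\int[lebesgue_measure]_(u in `[0, tau]) flow b x u)%:E.
Proof.
rewrite -/(hazard (flow b x) 0 tau) -(hazardE (mflow b x) (flow_bnd b x)).
rewrite [RHS]integral_mkcond; apply: eq_integral => u _.
rewrite patchE mem_setE in_itv/= occupation1E /window -EFinM.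
by case: ifP => // _; rewrite mul0r.
Qed.

Lemma tail_equation y tau : 0 <= tau ->
  tail_prob y tau = (y <= 0)%R%:R +
    \int[lebesgue_measure]_(u in `[0, tau]) drift lambda omega tail_prob y u.
Proof.
move=> tau0; have := flux_equation y tau0.
rewrite !flowE -[V in (V + _)%E = _]fineK ?occupation_fin// -/(tail_prob y tau) -!EFinD.
case=> E.
have int b x : lebesgue_measure.-integrable `[0, tau] (EFin \o flow b x).
  exact: (integrable_rate (mflow b x) (flow_bnd b x)).
rewrite (_ : \int[lebesgue_measure]_(u in `[0, tau]) drift lambda omega tail_prob y u =
    \int[lebesgue_measure]_(u in `[0, tau]) (flow true (y - 1) u - flow false y u)); last first.
  (* Right jumps from [y - 1] and left jumps from [y] read the same conductance [omega (y - 1)],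
     which factors out. *)
  apply: eq_Rintegral => u _; rewrite /drift /flow /jump_rate subrK; ring.
by rewrite RintegralB//; lra.
Qed.

End Occupation.

(** * Comparison in a fixed environment *)

Section Comparison.
Variables (R : realType) (w G : int -> R -> R) (K c : R).
Hypotheses (K0 : 0 < K) (c0 : 0 < c).
Hypothesis mG : forall y, measurable_fun setT (G y).
Hypothesis GK : forall y v, `|G y v| <= K.
Hypothesis wG : forall y t, 0 <= t ->
  w y t = \int[lebesgue_measure]_(v in `[0, t]) G y v.
Hypothesis w_lb : forall y v, - 1 <= w y v.
Hypothesis G_lb : forall v B, 0 <= v -> 0 <= B -> (forall x, - B <= w x v) ->
  forall y, w y v <= 0 -> - (c * B) <= G y v.

Let intG y (s t : R) (b b' : bool) :
  lebesgue_measure.-integrable [set` Interval (BSide b s) (BSide b' t)] (EFin \o G y).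
Proof.
apply: measurable_bounded_integrable => //.
- by rewrite /= lebesgue_measure_itv/=; case: ifP; rewrite ltry.
- exact: (measurable_funTS (mG y)).
- exists K; split; first exact: num_real.
  by move=> x Kx v _ /=; apply: le_trans (GK y v) (ltW Kx).
Qed.

Let increment y s t : 0 <= s -> s <= t ->
  w y t - w y s = \int[lebesgue_measure]_(v in `]s, t]) G y v.
Proof.
by move=> s0 st; rewrite !wG ?(le_trans s0)// Rintegral_itvB ?bnd_simp.
Qed.

Let increment_ge y s t m : 0 <= s -> s <= t ->
  (forall v, s < v <= t -> - m <= G y v) -> - (m * (t - s)) <= w y t - w y s.
Proof.
move=> s0 st Gm; rewrite increment//.
have -> : - (m * (t - s)) = \int[lebesgue_measure]_(v in `]s, t]) - m.
  rewrite Rintegral_cst//= lebesgue_measure_itv/= lte_fin.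
  case: ltP => [_|ts]; first by rewrite /= mulNr.
  by rewrite (le_anti (introT andP (conj st ts))) subrr !mulr0 oppr0.
apply: le_Rintegral => //.
apply: measurable_bounded_integrable => //.
- by rewrite /= lebesgue_measure_itv/=; case: ifP; rewrite ltry.
- exists `|m|; split; first exact: num_real.
  by move=> x mx v _ /=; rewrite normrN ltW.
Qed.

Let lipschitz y s t : 0 <= s -> s <= t -> w y s - K * (t - s) <= w y t.
Proof.
move=> s0 st.
have : - (K * (t - s)) <= w y t - w y s.
  by apply: increment_ge => // v _; have := GK y v; rewrite ler_norml => /andP[].
lra.
Qed.

(** [G_lb] bounds [G] only where [w] is nonpositive, so the drift has to be integrated from the last
    time at which [w] was nonnegative. *)
Let last_nonneg y a t : 0 <= a -> a <= t -> 0 <= w y a ->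
  exists2 s, a <= s <= t & 0 <= w y s /\ forall v, s < v <= t -> w y v < 0.
Proof.
move=> a0 at_ wa; pose E := [set s | a <= s <= t /\ 0 <= w y s].
have Ea : E a by split; rewrite ?lexx.
have supE : has_sup E.
  by split; [exists a|exists t => s [/andP[]]].
have as0 : a <= sup E by apply: ub_le_sup => //; exact: supE.2.
have s0t : sup E <= t by apply: ge_sup; [exists a|move=> s [/andP[]]].
exists (sup E); first by rewrite as0.
split; last first.
  move=> v /andP[sv vt]; rewrite ltNge; apply/negP => wv.
  have : v <= sup E.
    by apply: ub_le_sup; [exact: supE.2|split; rewrite ?vt ?andbT ?(le_trans as0 (ltW sv))].
  by rewrite leNgt sv.
rewrite leNgt; apply/negP => wlt.
(* By the Lipschitz bound, a negative value at [sup E] would keep [w] negative on a left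
   neighbourhood of this length, away from [E]. *)
have d0 : 0 < - w y (sup E) / K by rewrite divr_gt0 ?oppr_gt0.
have [s [/andP[as_ st] ws] sd] := sup_adherent d0 supE.
have ss : s <= sup E by apply: ub_le_sup; [exact: supE.2|split; rewrite ?as_ ?st].
have := lipschitz y (le_trans a0 as_) ss.
have : K * (sup E - s) < - w y (sup E).
  by rewrite mulrC -ltr_pdivlMr//; lra.
lra.
Qed.

Let h := (2 * c)^-1.
Let h0 : 0 < h. Proof. by rewrite invr_gt0 mulr_gt0. Qed.

(* A time step h with c h = 1 / 2 improves the lower bound -B to -B / 2. *)
Let halving a n : 0 <= a -> (forall y, 0 <= w y a) ->
  forall y t, a <= t <= a + h -> - 2^-1 ^+ n <= w y t.
Proof.
move=> a0 wa; elim: n => [|n IH] y t /andP[at_ th]; first by rewrite expr0.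
have [s /andP[as_ st] [ws wneg]] := last_nonneg a0 at_ (wa y).
have s0 := le_trans a0 as_.
have B0 : 0 <= (2^-1 ^+ n : R) by rewrite exprn_ge0.
have : - (c * 2^-1 ^+ n * (t - s)) <= w y t - w y s.
  apply: increment_ge => // v /andP[sv vt].
  apply: G_lb => //; first by rewrite (le_trans s0)// ltW.
    by move=> x; apply: IH; rewrite (le_trans as_ (ltW sv)) (le_trans vt).
  by apply/ltW/wneg; rewrite sv.
have : c * 2^-1 ^+ n * (t - s) <= 2^-1 ^+ n.+1.
  have ht : c * (t - s) <= 2^-1.
    apply: (@le_trans _ _ (c * h)); first by rewrite ler_pM2l//; lra.
    by rewrite /h invfM mulrCA divff ?mulr1// gt_eqF.
  by rewrite exprS mulrAC ler_wpM2r.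
lra.
Qed.

(** Iterating [halving] without end gives [0 <= w] on a block of length [h]. Since [h] does not
    depend on where the block starts, induction over blocks reaches every time. *)
Lemma comparison y t : 0 <= t -> 0 <= w y t.
Proof.
move=> t0.
have wa (k : nat) : forall x, forall s, 0 <= s <= k%:R * h -> 0 <= w x s.
  elim: k => [|k IH] x s /andP[s0 sk].
    move: sk; rewrite mul0r => sk; rewrite wG// (le_anti (introT andP (conj sk s0))).
    by rewrite set_itv1 Rintegral_set1.
  have [sk'|ks] := leP s (k%:R * h); first by apply: IH; rewrite s0.
  have k0 : 0 <= k%:R * h by rewrite mulr_ge0// ltW.
  have half n : - 2^-1 ^+ n <= w x s.
    apply: (halving n k0); last by move: sk; rewrite (ltW ks)/= -natr1 mulrDl mul1r.
    by move=> y'; apply: IH; rewrite k0 lexx.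
  rewrite leNgt; apply/negP => wneg.
  have z0 : 0 < - w x s by rewrite oppr_gt0.
  (* An exponent with 2^N > N > 1 / z for z = [- w x s], so that the bound [- 2^-1 ^+ N] is
     violated. *)
  pose N := (Num.truncn (- w x s)^-1).+1.
  have NlT : (N%:R : R) < 2 ^+ N by rewrite -natrX ltr_nat ltn_expl.
  have := half N; rewrite lerNl exprVn -(invrK (- w x s)) lef_pV2 ?posrE ?invr_gt0 ?exprn_gt0//.
  by apply/negP; rewrite -ltNge (lt_trans _ NlT)// truncnS_gt.
have := wa (Num.truncn (t / h)).+1 y t; apply.
by rewrite t0 -ler_pdivrMr// ltW// truncnS_gt.
Qed.

End Comparison.

Section QuenchedComparison.
Variables (R : realType) (omega : int -> R -> R) (kappa lambda lambda' : R).
Hypothesis kappa0 : 0 < kappa.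
Hypothesis omega_bnd : forall x u, 0 <= omega x u <= kappa.
Hypothesis momega : forall x, measurable_fun setT (omega x).
Hypothesis le_lambda : lambda <= lambda'.
Variables (d : measure_display) (T : measurableType d) (P : probability T R).
Variable e : bool * nat -> T -> R.
Hypothesis me : forall i, measurable_fun setT (e i).
Hypothesis e0 : forall i w, 0 <= e i w.
Hypothesis law_e : forall i A, measurable A -> P (e i @^-1` A) = exponential_prob 1 A.
Hypothesis indep_e : independent_family P e.

Lemma drift_bnd (l : R) (f : int -> R -> R) y u :
  (forall y, 0 <= f y u <= 1) -> (forall y, f (y + 1) u <= f y u) ->
  `|drift l omega f y u| <= rate_bound kappa l.
Proof.
move=> f01 fdec; rewrite /drift /rate_bound normrM.
have /andP[w0 wk] := omega_bnd (y - 1) u.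
rewrite (ger0_norm w0) ler_pM// ler_norml.
have := f01 (y - 1); have := f01 y; have := f01 (y + 1).
have := fdec (y - 1); rewrite subrK; have := fdec y.
have := expR_gt0 l; have := expR_gt0 (- l).
move: (expR l) (expR (- l)) (f (y - 1) u) (f y u) (f (y + 1) u) => L l' a b c.
move=> l0 L0 cb ba /andP[c0 c1] /andP[b0 b1] /andP[a0 a1].
have h1 : L * (a - b) <= L by rewrite -[leRHS]mulr1 ler_pM2l//; lra.
have h2 : l' * (b - c) <= l' by rewrite -[leRHS]mulr1 ler_pM2l//; lra.
have h3 : 0 <= L * (a - b) by rewrite mulr_ge0 ?subr_ge0// ltW.
have h4 : 0 <= l' * (b - c) by rewrite mulr_ge0 ?subr_ge0// ltW.
by apply/andP; split; lra.
Qed.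

Lemma measurable_drift (l : R) (f : int -> R -> R) y :
  (forall y, measurable_fun setT (f y)) -> measurable_fun setT (drift l omega f y).
Proof.
move=> mf; apply: measurable_funM => //.
by apply: measurable_funB; apply: measurable_funM => //; exact: measurable_funB.
Qed.

Local Notation tail l := (tail_prob omega l P e).

Lemma le_tail_prob y t : 0 <= t -> tail lambda y t <= tail lambda' y t.
Proof.
have bnd l x v := @tail_prob_bnd _ _ _ l kappa0 omega_bnd momega _ _ P _ me x v.
have dec l x v := @tail_prob_nincr _ _ _ l kappa0 omega_bnd momega _ _ P _ me x v.
have mt l x := @measurable_tail_prob _ _ _ l kappa0 omega_bnd momega _ _ P _ me x.
pose w y v := tail lambda' y v - tail lambda y v.
pose G y v := drift lambda' omega (tail lambda') y v - drift lambda omega (tail lambda) y v.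
have Gbnd l x v : `|drift l omega (tail l) x v| <= rate_bound kappa l.
  by apply: drift_bnd => ?; [exact: bnd|exact: dec].
have mdr l x : measurable_fun setT (drift l omega (tail l) x) by exact: measurable_drift.
have c0 l : 0 < rate_bound kappa l by exact: rate_bound_gt0.
have idr l x s : lebesgue_measure.-integrable `[0, s] (EFin \o drift l omega (tail l) x).
  apply: measurable_bounded_integrable => //.
  - by rewrite /= lebesgue_measure_itv/=; case: ifP; rewrite ltry.
  - exact: (measurable_funTS (mdr l x)).
  - exists (rate_bound kappa l); split; first exact: num_real.
    by move=> z zx v _ /=; apply: le_trans (Gbnd l x v) (ltW zx).
move=> t0; rewrite -subr_ge0 -/(w y t); move: y t t0.
apply: (@comparison _ w G (rate_bound kappa lambda' + rate_bound kappa lambda)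
  (rate_bound kappa lambda')) => //.
- by rewrite addr_gt0.
- by move=> x; exact: measurable_funB.
- by move=> x v; apply: (le_trans (ler_normB _ _)); exact: lerD.
- move=> x s s0; rewrite /w (tail_equation lambda' kappa0)// (tail_equation lambda kappa0)//.
  rewrite RintegralB//.
  by rewrite opprD addrACA subrr add0r.
- move=> x v; rewrite /w; have /andP[_ b1] := bnd lambda x v.
  have /andP[a0 _] := bnd lambda' x v; move: (tail _ _ _) (tail _ _ _) a0 b1 => a b.
  by lra.
move=> v B v0 B0 wB x wx; rewrite /G /drift /rate_bound.
have /andP[w0 wk] := omega_bnd (x - 1) v.
have L0 := expR_gt0 lambda; have l0 := expR_gt0 (- lambda').
have LL : expR lambda <= expR lambda' by rewrite ler_expR.
have ll : expR (- lambda') <= expR (- lambda) by rewrite ler_expR lerN2.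
have fa := dec lambda (x - 1) v; rewrite subrK in fa.
have fb := dec lambda x v.
have wa := wB (x - 1); have wb := wB (x + 1); move: wa wb wx; rewrite /w.
move: (omega (x - 1) v) w0 wk => om w0 wk.
move: (expR lambda) (expR lambda') (expR (- lambda)) (expR (- lambda')) L0 l0 LL ll.
move=> L L' l l' L0 l0 LL ll.
move: fa fb; move: (tail lambda (x - 1) v) (tail lambda x v) (tail lambda (x + 1) v) => a b c.
move: (tail lambda' (x - 1) v) (tail lambda' x v) (tail lambda' (x + 1) v) => a' b' c'.
move=> ba cb wa wc wb.
(* The drift difference, divided by the conductance, splits into the operator for [lambda'] applied
   to [w] ([h1], [h2]), bounded below since [w] is nonpositive at [x] and at least [- B] at its
   neighbours, and the effect of changing the bias on the old tail ([h3], [h4]), nonnegative because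
   that tail decreases in the site. *)
have h1 : - (L' * B) <= L' * ((a' - a) - (b' - b)).
  by rewrite -mulrN ler_pM2l; lra.
have h2 : - (l' * B) <= l' * ((c' - c) - (b' - b)).
  by rewrite -mulrN ler_pM2l; lra.
have h3 : 0 <= (L' - L) * (a - b) by rewrite mulr_ge0 ?subr_ge0.
have h4 : 0 <= (l - l') * (b - c) by rewrite mulr_ge0 ?subr_ge0.
have h5 : - ((L' + l') * B) <= L' * (a' - b') - l' * (b' - c') - (L * (a - b) - l * (b - c)).
  lra.
rewrite -mulrBr; apply: le_trans (ler_wpM2l w0 h5).
rewrite mulrN lerN2 -mulrA ler_wpM2r// mulr_ge0//; lra.
Qed.

(** The window containing [t] is unique when it exists, and it fails to exist only on the null event
    of explosion, where [walk] takes its default index. *)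
Lemma walk_tailE l (y : int) t : 0 <= t ->
  P [set w | y <= walk omega l (clocks (fun i => e i w)) t] = (tail l y t)%:E.
Proof.
move=> t0; have mclkT b n : measurable_fun setT (fun w => clocks (fun i => e i w) b n).
  exact: me.
have mv D := measurable_visited l kappa0 omega_bnd momega me D t.
have mwalk : measurable [set w | y <= walk omega l (clocks (fun i => e i w)) t].
  apply: measurable_setb.
  apply: (measurable_glue (X := fun w => walk omega l (clocks (fun i => e i w)) t)
    (f := fun x _ => y <= x)) => //.
  apply: (@measurable_walk _ _ _ (fun=> omega) kappa) => // x.
  exact: (measurableT_comp (momega x)).
rewrite /tail_prob fineK; last exact: (occupation_fin l kappa0).
have /eqP aliveT : occupation omega l P e predT t == 1%E.
  by rewrite (occupationT l kappa0).
have walkE w n : visits omega l e predT t n w ->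
    walk omega l (clocks (fun i => e i w)) t = jump_pos omega l (clocks (fun i => e i w)) n.
  move=> /andP[al _]; rewrite /walk (_ : xget _ _ = n)//.
  apply: xget_unique; first exact/andP.
  by move=> m /andP am; exact: (jump_time_window am al).
set A := [set w | exists n, visits omega l e predT t n w] in aliveT *.
rewrite /occupation in aliveT *.
have AC0 : P (~` A) = 0%E.
  have := probability_setC P (mv predT); rewrite -/A aliveT subee//.
apply/eqP; rewrite eq_le; apply/andP; split; last first.
  apply: le_measure; [exact/mem_set/mv|exact/mem_set|].
  move=> w /= [n /andP[al yX]]; rewrite (walkE w n)//.
  by rewrite /visits al.
rewrite -[leRHS]adde0 -AC0.
apply: le_trans (measureU2 _ _ _); last 2 first.
- exact: mv.
- by apply: measurableC; exact: mv.
apply: le_measure; [exact/mem_set| |].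
  by apply/mem_set/measurableU; [exact: mv|apply: measurableC; exact: mv].
move=> w /= yw; have [[n vn]|nA] := pselect (A w); last by right.
left; exists n; move: (vn) => /andP[al _].
by rewrite /visits al -(walkE w n).
Qed.

Lemma le_walk_prob (y : int) t : 0 <= t ->
  (P [set w | (y <= walk omega lambda (clocks (fun i => e i w)) t)%R] <=
   P [set w | (y <= walk omega lambda' (clocks (fun i => e i w)) t)%R])%E.
Proof.
move=> t0; rewrite [leLHS](walk_tailE lambda y t0) [leRHS](walk_tailE lambda' y t0) lee_fin.
exact: le_tail_prob.
Qed.

End QuenchedComparison.

(** * Comparison of the annealed laws *)

Section Annealed.
Variables (R : realType) (kappa : R).
Hypothesis kappa0 : 0 < kappa.

Local Notation noise := (noise_space R noise_index).

(* Clipping changes nothing almost surely, but makes the conductances bounded and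
   the refresh count measurable for every noise: with negative gaps several
   windows may contain t, and xget then selects one by choice. *)
Definition clipped_env (k : noise_index -> R) : int -> R -> R :=
  conductance (fun x n => Num.min (Num.max (k (inl (inl (x, n)))) 0) kappa)
              (fun x n => Num.max (k (inl (inr (x, n)))) 0).

Definition clipped_clk (k : noise_index -> R) (b : bool) (n : nat) : R :=
  Num.max (k (inr (b, n))) 0.

Definition noise_walk (lambda t : R) (k : noise_index -> R) : int :=
  walk (clipped_env k) lambda (clipped_clk k) t.

Lemma clipped_env_bnd k x u : 0 <= clipped_env k x u <= kappa.
Proof.
by rewrite /clipped_env /conductance le_min le_max lexx orbT (ltW kappa0)/= ge_min lexx orbT.
Qed.

Lemma measurable_clipped_env d (W : measurableType d) (f : W -> noise) x :
  measurable_fun setT f ->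
  measurable_fun setT (fun p : W * R => clipped_env (f p.1) x p.2).
Proof.
move=> mf; apply: (measurable_conductance
  (eta := fun w x n => Num.min (Num.max (f w (inl (inl (x, n)))) 0) kappa)
  (tau := fun w x n => Num.max (f w (inl (inr (x, n)))) 0)) => [y n|y n|w y n].
- apply: measurable_minr => //; apply: measurable_maxr => //.
  exact: (measurableT_comp (measurable_coord _) mf).
- by apply: measurable_maxr => //; exact: (measurableT_comp (measurable_coord _) mf).
- by rewrite le_max lexx orbT.
Qed.

Lemma measurable_noise_walk lambda t :
  measurable_discrete (fun k : noise => noise_walk lambda t k).
Proof.
apply: (@measurable_walk R _ noise (fun k => clipped_env k) kappa lambda kappa0) => //.
- by move=> k x u; exact: clipped_env_bnd.
- by move=> x; apply: (measurable_clipped_env (f := id)).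
- by move=> b n; apply: measurable_maxr => //; exact: measurable_coord.
Qed.

Lemma measurable_noise_walk_ge lambda t (y : int) :
  measurable_fun setT (fun k : noise => y <= noise_walk lambda t k).
Proof.
exact: (measurable_glue (measurable_noise_walk lambda t) (f := fun x _ => y <= x)).
Qed.

(** Clipping moves only negative points, where the density vanishes. *)
Lemma exponential_law_max (mu : R) (A : set R) :
  exponential_prob mu ((fun z => Num.max z 0) @^-1` A) = exponential_prob mu A.
Proof.
rewrite /exponential_prob integral_mkcond [RHS]integral_mkcond.
apply: eq_integral => z _; rewrite !patchE; have [z0|z0] := ltP z 0.
  by rewrite lt0_exponential_pdf//; do 2 case: ifP.
rewrite (_ : (z \in _ @^-1` A) = (z \in A))//.
by apply/idP/idP; rewrite !inE/= max_l.
Qed.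

Variables (q : set R -> \bar R) (mu : R).

Section Coordinates.
Variables (d : measure_display) (T : measurableType d) (P : probability T R).
Variables (eta tau : int -> nat -> {RV P >-> R}) (clk : bool -> nat -> {RV P >-> R}).
Hypothesis dn : driving_noise q mu eta tau clk.

Definition coords (i : noise_index) (w : T) : R := noise_family eta tau clk i w.

Lemma measurable_coords i : measurable_fun setT (coords i).
Proof. exact: measurable_funPT. Qed.

Lemma independent_coords : independent_family P coords.
Proof. exact: noise_independent dn. Qed.

Definition clipped_level (i : bool * nat) (w : T) : R := Num.max (coords (inr i) w) 0.

Lemma measurable_clipped_level i : measurable_fun setT (clipped_level i).
Proof. by apply: measurable_maxr => //; exact: measurable_coords. Qed.

Lemma clipped_level_ge0 i w : 0 <= clipped_level i w.
Proof. by rewrite le_max lexx orbT. Qed.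

Let mmax : measurable_fun setT (fun z : R => Num.max z 0).
Proof. exact: measurable_maxr. Qed.

Lemma clipped_level_law i A : measurable A ->
  P (clipped_level i @^-1` A) = exponential_prob 1 A.
Proof.
move=> mA; rewrite -exponential_law_max; case: i => b n.
rewrite -(clock_law dn b n)//.
exact: measurable_preimage.
Qed.

Lemma independent_clipped_level : independent_family P clipped_level.
Proof.
move=> s B us mB.
pose B' (i : noise_index) := if i is inr j then (fun z : R => Num.max z 0) @^-1` B j else setT.
have us' : uniq [seq inr j : noise_index | j <- s] by rewrite map_inj_uniq// => i j [].
have mB' i : measurable (B' i).
  by case: i => [a|j]; [exact: measurableT|exact: (measurable_preimage mmax (mB j))].
have := independent_coords us' mB'; rewrite big_map => <-.
congr (P _); apply/seteqP; split=> w /= h i /=.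
  by move=> /mapP[j sj ->]; exact: h.
by move=> si; apply: (h (inr i)); rewrite /= map_f.
Qed.

End Coordinates.

Section Transport.
Variables (d d' : measure_display) (T : measurableType d) (T' : measurableType d').
Variables (P : probability T R) (P' : probability T' R).
Variables (eta tau : int -> nat -> {RV P >-> R}) (clk : bool -> nat -> {RV P >-> R}).
Variables (eta' tau' : int -> nat -> {RV P' >-> R}) (clk' : bool -> nat -> {RV P' >-> R}).
Hypothesis dn : driving_noise q mu eta tau clk.
Hypothesis dn' : driving_noise q mu eta' tau' clk'.
Variables (lambda lambda' : R).
Hypothesis le_lambda : lambda <= lambda'.

Lemma coords_law i B : measurable B ->
  P (coords eta tau clk i @^-1` B) = P' (coords eta' tau' clk' i @^-1` B).
Proof.
move=> mB; case: i => [[[x n]|[x n]]|[b n]].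
- transitivity (q B); first exact: (conductance_law dn x n mB).
  exact: esym (conductance_law dn' x n mB).
- transitivity (exponential_prob mu B); first exact: (refresh_gap_law dn x n mB).
  exact: esym (refresh_gap_law dn' x n mB).
- transitivity (exponential_prob 1 B); first exact: (clock_law dn b n mB).
  exact: esym (clock_law dn' b n mB).
Qed.

(** The walk is a measurable function of the noise, so the [lambda] walk can be carried to [P'];
    there the quenched comparison is integrated over the environment. *)
Lemma annealed_comparison (y : int) t : 0 <= t ->
  (P [set w | (y <= noise_walk lambda t (fun i => coords eta tau clk i w))%R] <=
   P' [set w | (y <= noise_walk lambda' t (fun i => coords eta' tau' clk' i w))%R])%E.
Proof.
move=> t0.
pose X w : noise := fun i => coords eta tau clk i w.
pose X' w : noise := fun i => coords eta' tau' clk' i w.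
have mX : measurable_fun setT X by apply: measurable_fun_noise => i; exact: measurable_coords.
have mX' : measurable_fun setT X' by apply: measurable_fun_noise => i; exact: measurable_coords.
pose F l (k : noise) : \bar R := (if y <= noise_walk l t k then 1 else 0)%:E.
have mF l : measurable_fun setT (F l).
  by apply/measurable_EFinP; apply: measurable_fun_ifT => //; exact: measurable_noise_walk_ge.
have F0 l k : (0 <= F l k)%E by rewrite /F lee_fin; case: ifP.
have mge l : measurable_fun setT (fun w => y <= noise_walk l t (X' w)).
  exact: (measurableT_comp (measurable_noise_walk_ge l t y) mX').
have PE : P [set w | y <= noise_walk lambda t (X w)] = (\int[P]_w F lambda (X w))%E.
  by rewrite -(integral_ifb P (measurableT_comp (measurable_noise_walk_ge lambda t y) mX)).
have PE' : P' [set w | y <= noise_walk lambda' t (X' w)] = (\int[P']_w F lambda' (X' w))%E.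
  by rewrite -(integral_ifb P' (mge lambda')).
rewrite PE PE'.
pose D (i : noise_index) := if i is inl _ then true else false.
pose mix w1 w2 : noise := fun i => if D i then X' w1 i else X' w2 i.
have mc' i : measurable_fun setT (coords eta' tau' clk' i) by exact: measurable_coords.
have splitE l : (\int[P']_w F l (X' w) = \int[P']_w1 \int[P']_w2 F l (mix w1 w2))%E.
  exact: (integral_noise_split mc' (independent_coords dn') D (mF l) (F0 l)).
have mmix : measurable_fun setT (fun p : T' * T' => mix p.1 p.2).
  apply: measurable_fun_noise => i; rewrite /mix; case: (D i).
    exact: (measurableT_comp (mc' i)).
  exact: (measurableT_comp (mc' i)).
have mFmix l : measurable_fun setT (fun p : T' * T' => F l (mix p.1 p.2)).
  exact: (measurableT_comp (mF l) mmix).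
apply: (@le_trans _ _ (\int[P']_w F lambda (X' w))%E).
  rewrite le_eqVlt; apply/orP; left; apply/eqP.
  apply: (integral_noise_law (X := coords eta tau clk) (X' := coords eta' tau' clk')
    _ _ (independent_coords dn) (independent_coords dn') _ (mF lambda) (F0 lambda)).
  - exact: measurable_coords.
  - exact: measurable_coords.
  - exact: coords_law.
have le_eq2 (a b a' b' : \bar R) : a = a' -> b = b' -> (a' <= b' -> a <= b)%E by move=> -> ->.
apply: (le_eq2 _ _ _ _ (splitE lambda) (splitE lambda')).
apply: ge0_le_integral.
- exact: measurableT.
- by move=> w1 _; apply: integral_ge0 => w2 _; exact: F0.
- exact: (@measurable_fun_fubini_tonelli_F _ _ _ _ _ P'
    (fun p => F lambda (mix p.1 p.2)) (mFmix lambda)).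
- exact: (@measurable_fun_fubini_tonelli_F _ _ _ _ _ P'
    (fun p => F lambda' (mix p.1 p.2)) (mFmix lambda')).
move=> w1 _.
have mw l : measurable_fun setT (fun w2 => y <= noise_walk l t (mix w1 w2)).
  apply: (measurableT_comp (measurable_noise_walk_ge l t y)).
  exact: (measurable_fun_pair2 w1 mmix).
apply: (le_eq2 _ _ _ _ (integral_ifb P' (mw lambda)) (integral_ifb P' (mw lambda'))).
apply: (@le_walk_prob R (clipped_env (X' w1)) kappa lambda lambda' kappa0 _ _ le_lambda
  _ _ P' (clipped_level eta' tau' clk')).
- exact: clipped_env_bnd.
- move=> x; have := measurable_clipped_env x (@measurable_cst _ _ T' noise setT (X' w1)).
  by move=> h; exact: (measurable_fun_pair2 w1 h).
- exact: measurable_clipped_level.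
- exact: clipped_level_ge0.
- exact: clipped_level_law.
- exact: independent_clipped_level.
- exact: t0.
Qed.

End Transport.
End Annealed.

(** * From almost sure speeds to probabilities *)

Lemma probability_eventually (d : measure_display) (T : measurableType d) (R : realType)
    (P : probability T R) (A : nat -> T -> bool) :
  (forall n, measurable_fun setT (A n)) ->
  {ae P, forall w, \forall n \near \oo, A n w} ->
  P [set w | A n w] @[n --> \oo] --> 1%E.
Proof.
move=> mA Aev.
pose f n w : \bar R := (if A n w then 1 else 0)%:E.
have mf n : measurable_fun setT (f n).
  by apply/measurable_EFinP; exact: measurable_fun_ifT.
have f_cvg : {ae P, forall w, setT w -> f ^~ w @ \oo --> (1 : \bar R)%E}.
  move: Aev; apply: filterS => w Aw _; apply: cvg_near_cst.
  by move: Aw; apply: filterS => n; rewrite /f => ->.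
have f_le : {ae P, forall w n, setT w -> (`|f n w| <= cst 1 w)%E}.
  by apply: aeW => w n _; rewrite /f /=; case: ifP => _; rewrite lee_fin ?normr1 ?normr0.
have [_ _] := @dominated_convergence _ _ _ P _ measurableT f (cst 1%E) (cst 1%E)
  mf (measurable_cst _) f_cvg (finite_measure_integrable_cst P 1 measurableT) f_le.
rewrite integral_cst//= probability_setT mule1.
rewrite (_ : (fun n => (\int[P]_w f n w)%E) = fun n => P [set w | A n w])//.
by apply/funext => n; rewrite integral_ifb.
Qed.

Section Clipping.
Variables (R : realType) (kappa : R) (q : probability (measurableTypeR R) R).
Hypothesis q_support : q `[0, kappa]%classic = 1%E.
Variables (mu : R) (d : measure_display) (T : measurableType d) (P : probability T R).
Variables (eta tau : int -> nat -> {RV P >-> R}) (clk : bool -> nat -> {RV P >-> R}).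
Hypothesis dn : driving_noise q mu eta tau clk.

Let range_of (i : noise_index) : set R :=
  if i is inl (inl _) then `[0, kappa]%classic else `[0, +oo[%classic.

Let exponential_neg (nu : R) : exponential_prob nu (~` `[0, +oo[%classic) = 0%E.
Proof.
rewrite /exponential_prob integral_mkcond integral0_eq// => z _.
rewrite patchE; case: ifPn => //; rewrite inE/= in_itv/= andbT => /negP.
by rewrite -ltNge => z0; rewrite lt0_exponential_pdf.
Qed.

Let ae_range i : {ae P, forall w, range_of i (coords eta tau clk i w)}.
Proof.
have mC : measurable (~` range_of i).
  by apply: measurableC; case: i => [[|]|] *; exact: measurable_itv.
exists (coords eta tau clk i @^-1` ~` range_of i); split => //.
- exact: (measurable_preimage (measurable_coords eta tau clk i)).
- move: mC; case: i => [[[x n]|[x n]]|[b n]] mC.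
  + transitivity (q (~` `[0, kappa]%classic)); first exact: (conductance_law dn x n mC).
    have := @probability_setC _ _ _ q `[0, kappa]%classic (measurable_itv _).
    by rewrite q_support subee.
  + transitivity (exponential_prob mu (~` `[0, +oo[%classic)); last exact: exponential_neg.
    exact: (refresh_gap_law dn x n mC).
  + transitivity (exponential_prob (1 : R) (~` `[0, +oo[%classic)); last exact: exponential_neg.
    exact: (clock_law dn b n mC).
Qed.

Lemma ae_vbrw_noise_walk lambda : {ae P, forall w, forall t,
  vbrw lambda (fun x n => eta x n) (fun x n => tau x n) (fun b n => clk b n) t w =
  noise_walk kappa lambda t (fun i => coords eta tau clk i w)}.
Proof.
(* There are countably many coordinates, so their almost sure ranges hold jointly; pickling turns
   them into a family indexed by [nat]. *)
have : {ae P, forall w, forall n : nat,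
    if unpickle n is Some i then range_of i (coords eta tau clk i w) else True}.
  apply: ae_foralln => n; case: (unpickle n) => [i|]; first exact: ae_range.
  exact: aeW.
apply: filterS => w good t.
have {}good i : range_of i (coords eta tau clk i w).
  by have := good (pickle i); rewrite pickleK.
have envE : clipped_env kappa (fun i => coords eta tau clk i w) =
    conductance (fun x n => eta x n w) (fun x n => tau x n w).
  rewrite /clipped_env; congr (conductance _ _); apply/funext => x; apply/funext => n.
    have := good (inl (inl (x, n))); rewrite /= in_itv/= => /andP[e0 ek].
    by rewrite max_l// min_l.
  have := good (inl (inr (x, n))); rewrite /= in_itv/= andbT => e0.
  by rewrite max_l.
have clkE : clipped_clk (fun i => coords eta tau clk i w) = fun b n => clk b n w.
  apply/funext => b; apply/funext => n; rewrite /clipped_clk.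
  have := good (inr (b, n)); rewrite /= in_itv/= andbT => e0.
  by rewrite max_l.
by rewrite /noise_walk envE clkE.
Qed.

Lemma ae_speed_noise_walk (lambda v : R) :
  {ae P, forall w, (vbrw lambda (fun x n => eta x n) (fun x n => tau x n)
     (fun b n => clk b n) t w)%:~R / t @[t --> +oo] --> v} ->
  {ae P, forall w, ((noise_walk kappa lambda n%:R (fun i => coords eta tau clk i w))%:~R / n%:R)
     @[n --> \oo] --> v}.
Proof.
move: (ae_vbrw_noise_walk lambda); apply: filterS2 => w eqw cw.
have := cvg_comp _ _ (@cvgr_idn R) cw.
by under eq_fun do rewrite /= eqw.
Qed.

End Clipping.

Theorem theorem25 (R : realType) (kappa : R)
    (q : probability (measurableTypeR R) R)
    (kappa_gt0 : 0 < kappa)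
    (q_support : q `[0, kappa]%classic = 1%E)
    (q_neq_dirac0 : ~ (forall A : set R, measurable A -> q A = \d_(0 : R) A))
    (lambda epsilon : R) (lambda_gt0 : 0 < lambda) (epsilon_gt0 : 0 < epsilon)
    (mu : R) (mu_gt0 : 0 < mu) (v v' : R)
    (speed_lambda : is_speed q lambda mu v)
    (speed_lambda_epsilon : is_speed q (lambda + epsilon) mu v') :
  v <= v'.
Proof.
move: speed_lambda => [d [T [P [eta [tau [clk [dn cvgX]]]]]]].
move: speed_lambda_epsilon => [d' [T' [P' [eta' [tau' [clk' [dn' cvgX']]]]]]].
rewrite leNgt; apply/negP => vv'.
(* A level strictly between the speeds, which under the contrary assumption are ordered as v' < c <
   v. *)
pose c := (v + v') / 2.
pose Z n w := noise_walk kappa lambda n%:R (fun i => coords eta tau clk i w).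
pose Z' n w := noise_walk kappa (lambda + epsilon) n%:R
  (fun i => coords eta' tau' clk' i w).
(* With the ceiling, an integer is at least [y n] exactly when it is at least [c * n]. *)
pose y (n : nat) : int := Num.ceil (c * n%:R).
have mZ n : measurable_fun setT (fun w => y n <= Z n w).
  apply: (measurableT_comp (measurable_noise_walk_ge kappa_gt0 lambda n%:R (y n))).
  by apply: measurable_fun_noise => i; exact: measurable_coords.
have mZ' n : measurable_fun setT (fun w => y n <= Z' n w).
  apply: (measurableT_comp (measurable_noise_walk_ge kappa_gt0 (lambda + epsilon) n%:R (y n))).
  by apply: measurable_fun_noise => i; exact: measurable_coords.
have cv : c < v by rewrite /c; lra.
have v'c : v' < c by rewrite /c; lra.
have PZ : P [set w | y n <= Z n w] @[n --> \oo] --> 1%E.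
  apply: probability_eventually => //.
  move: (ae_speed_noise_walk q_support dn cvgX); apply: filterS => w cw.
  have : \forall n \near \oo, c < (Z n w)%:~R / n%:R :> R by apply: cvgr_gt cv.
  move=> cZ; near=> n.
  have n0 : 0 < n%:R :> R by rewrite ltr0n; near: n; exact: nbhs_infty_gt.
  rewrite /y ceil_le_int -ler_pdivlMr//; apply: ltW; near: n; exact: cZ.
have PZ' : P' [set w | ~~ (y n <= Z' n w)] @[n --> \oo] --> 1%E.
  apply: probability_eventually => [n|]; first exact: measurable_neg.
  move: (ae_speed_noise_walk q_support dn' cvgX'); apply: filterS => w cw.
  have cZ : \forall n \near \oo, (Z' n w)%:~R / n%:R < c by apply: cvgr_lt v'c.
  near=> n.
  have n0 : 0 < n%:R :> R by rewrite ltr0n; near: n; exact: nbhs_infty_gt.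
  rewrite /y ceil_le_int -ler_pdivlMr// -ltNge; near: n; exact: cZ.
(* The comparison moves the first event to [P'], where it is disjoint from the second; yet both
   probabilities tend to 1. *)
have le1 n : (P [set w | (y n <= Z n w)%R] + P' [set w | ~~ (y n <= Z' n w)%R] <= 1)%E.
  have := @annealed_comparison R kappa kappa_gt0 q mu _ _ T T' P P' eta tau clk eta' tau' clk'
    dn dn' lambda (lambda + epsilon).
  rewrite lerDl (ltW epsilon_gt0) => /(_ isT (y n) n%:R (ler0n _ _)) PP'.
  apply: (le_trans (leeD2r _ PP')).
  rewrite -measureU; last 3 first.
  - by apply: measurable_setb; exact: mZ'.
  - by apply: measurable_setb; apply: measurable_neg; exact: mZ'.
  - by apply/seteqP; split=> // w [] /= a /negP.
  by apply: probability_le1; apply: measurableU;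
    apply: measurable_setb => //; exact: measurable_neg.
have two := @cvgeD _ _ _ _ _ _ 1%E 1%E isT PZ PZ'.
have : (1 + 1 <= 1 :> \bar R)%E.
  rewrite -[leLHS](cvg_lim (@ereal_hausdorff R) (two _)).
  by apply: lime_le; [apply/cvg_ex; exists (1 + 1)%E; exact: two|exact: nearW].
by rewrite -EFinD lee_fin; lra.
Unshelve. all: by end_near. Qed.
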